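(* Let $n\ge 4$ and let $\mathcal{O}_{2,n}$ be the matrix defined recursively below. Then the convex hull of the columns of $\mathcal{O}_{2,n}$ is the polytope of all matroids $\Omega_{2,n}$ of rank $2$ on $[n]$ (with coordinates of $\mathbb{R}^{\binom n2}$ indexed by Schubert matroids in the order $\sigma_n$ below). Construction. Set $\mathcal{O}_{2,4}$ to be the $6\times 7$ matrix $\big(I_6 \mid v\big)$ with $v=(0,0,0,0,2,-1)^{T}$. For $n\ge 4$, let $\mathcal{U}(n)$ be the matrix with $n-2$ rows whose columns are all distinct vectors $u\in\mathbb{Z}_{\ge0}^{n-2}$ with $(n-1,n-2,\dots,3,2)\,u=n$. Let $\mathcal{V}(4)=(0,2,-1)^{T}$, and for $n\ge 5$ let $\mathcal{V}(n)$ be the $(n-1)$-row matrix whose columns consist of a left block equal to the zero row $\mathbf 0^T$ stacked on top of $\mathcal{V}(n-1)$, and a right block equal to $\mathcal{U}(n)$ stacked on top of the row $\mathbf 1^{T}-\mathbf 1^{T}\mathcal{U}(n)$. For $n\ge 5$ define $$\mathcal{O}_{2,n}=\begin{pmatrix}\mathcal{O}_{2,n-1} & \mathbf 0 & \mathbf 0\\ \mathbf 0 & I_{n-1} & \mathcal{V}(n)\end{pmatrix}.$$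
   Context: For $1\le x_1<x_2\le n$, $S(x_1,x_2)$ is the rank-$2$ Schubert matroid on $[n]$ whose bases are the $2$-subsets $\{b_1<b_2\}$ with $b_1\ge x_1,b_2\ge x_2$; these represent the $\binom n2$ isomorphism classes of rank-2 Schubert matroids on $[n]$. Order them as follows: $\sigma_3=(S(2,3),S(1,3),S(1,2))$, and for $n\ge4$, $\sigma_n$ consists of $S(a+1,b+1)$ for $S(a,b)$ running through $\sigma_{n-1}$ in order, followed by $S(1,n),S(1,n-1),\dots,S(1,2)$. For a matroid $M$ on $[n]$, $\mathcal{P}(M)$ is its base polytope (convex hull of indicator vectors of bases), and $\mathbbm{1}(X)(x)=\frac1{n!}\sum_{\sigma\in S_n}\overline{\mathbbm 1}(X)(\sigma(x))$ is the symmetrized indicator function. For every isomorphism class $M$ of rank $r$ matroids on $[n]$ there is a unique expression $\mathbbm 1(\mathcal P(M))=\sum_{S}a_S\,\mathbbm 1(\mathcal P(S))$ over isomorphism classes $S$ of rank $r$ Schubert matroids on $[n]$ (its Schubert expansion); $o_M=(a_S)_S$. The polytope of all matroids is $\Omega_{r,n}=\operatorname{conv}\{o_M : M \text{ an isomorphism class of rank } r \text{ matroids on } [n]\}$. *)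

(* Defs.v *)
From HB Require Import structures.
From mathcomp Require Import all_boot all_order perm all_algebra.
From mathcomp Require Import boolp classical_sets reals convex numfun.

Set Implicit Arguments.
Unset Strict Implicit.
Unset Printing Implicit Defensive.

Import Order.TTheory GRing.Theory Num.Theory.

Local Open Scope ring_scope.

(** The ground set [n] = {1, ..., n} is represented by ['I_n]: the element
    [i : 'I_n] stands for the label [i.+1]. *)

(** [Bs] is the set of bases of a matroid of rank [r] on [n]. *)
Definition is_matroid (r n : nat) (Bs : {set {set 'I_n}}) : Prop :=
  [/\ Bs != finset.set0,
      forall B, B \in Bs -> #|B| = r
    & forall A B x, A \in Bs -> B \in Bs -> x \in A :\: B ->
        exists2 y, y \in B :\: A & y |: (A :\ x) \in Bs].

Definition schubert2 (n x1 x2 : nat) : {set {set 'I_n}} :=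
  [set [set b.1; b.2] | b : 'I_n * 'I_n
     & [&& (b.1 < b.2)%N, (x1 <= b.1.+1)%N & (x2 <= b.2.+1)%N]].

(** The order sigma_n; an entry [(x1, x2)] stands for S(x1, x2). *)
Fixpoint schubert2_order (n : nat) : seq (nat * nat) :=
  match n with
  | S ((S (S (S _))) as m) =>
      [seq (x.1.+1, x.2.+1) | x <- schubert2_order m]
        ++ [seq (1%N, b) | b <- rev (iota 2 m)]
  | 3 => [:: (2, 3); (1, 3); (1, 2)]%N
  | _ => [::]
  end.

Definition convex_hull (R : realType) (m : nat) (A : set 'cV[R]_m) :
    set 'cV[R]_m :=
  smallest (fun X : set 'cV[R]_m => convex_set X) A.

Definition base_polytope (R : realType) (n : nat) (Bs : {set {set 'I_n}}) :
    set 'cV[R]_n :=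
  convex_hull [set (\col_i (i \in B)%:R)%R | B in [set` Bs]]%classic.

Definition sym_indic (R : realType) (n : nat) (X : set 'cV[R]_n)
    (x : 'cV[R]_n) : R :=
  (n`!%:R)^-1 * \sum_(s : 'S_n) \1_X (row_perm s x).

Definition is_schubert_expansion (R : realType) (n : nat)
    (Bs : {set {set 'I_n}}) (a : 'cV[R]_('C(n, 2))) : Prop :=
  forall x : 'cV[R]_n,
    sym_indic (base_polytope Bs) x =
    \sum_(i < 'C(n, 2))
       let S := nth (0, 0)%N (schubert2_order n) i in
       a i 0 * sym_indic (base_polytope (schubert2 n S.1 S.2)) x.

(** The symmetrized indicator function is the same for isomorphic matroids, so
    that all matroids are used instead of one for each isomorphism class. *)
Definition Omega2 (R : realType) (n : nat) : set 'cV[R]_('C(n, 2)) :=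
  convex_hull [set a | exists2 Bs : {set {set 'I_n}},
    is_matroid 2 Bs & is_schubert_expansion Bs a]%classic.

Arguments Omega2 : clear implicits.

(** The columns of U(n), for [n >= 3].  Row [i], counted from 0, has weight
    [n - 1 - i]; the entries are at most [n] by [U_sol_bound]. *)
Definition U_sol (n : nat) : {set {ffun 'I_n.-2 -> 'I_n.+1}} :=
  [set u : {ffun 'I_n.-2 -> 'I_n.+1} |
     (\sum_(i < n.-2) (n.-1 - i) * u i == n)%N].

Lemma U_sol_bound (n : nat) (u : 'I_n.-2 -> nat) :
  (\sum_(i < n.-2) (n.-1 - i) * u i = n)%N -> forall i, (u i <= n)%N.
Proof.
move=> un i; rewrite -[leqRHS]un (bigD1 i)//= (leq_trans _ (leq_addr _ _))//.
by rewrite leq_pmull// subn_gt0 (leq_trans (ltn_ord i))//; case: (n) => // -[].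
Qed.

Definition U_mx (R : realType) (n : nat) : 'M[R]_(n.-2, #|U_sol n|) :=
  \matrix_(i, j) let u : {ffun 'I_n.-2 -> 'I_n.+1} := enum_val j in (u i)%:R.

Definition add_last_row (R : realType) (m p : nat)
    (A : 'M[R]_(m, p)) (v : 'rV[R]_p) : 'M[R]_(m.+1, p) :=
  castmx (addn1 m, erefl p) (col_mx A v).

Fixpoint V_ncols (n : nat) : nat :=
  match n with
  | S ((S (S (S (S _)))) as m) => (V_ncols m + #|U_sol m.+1|)%N
  | 4 => 1
  | _ => 0
  end.

(** Only the values at [n >= 4] are meaningful, also for [O2_rec] below; the
    inner match is applied to the previous matrix to refine its type. *)
Fixpoint V_mx (R : realType) (n : nat) : 'M[R]_(n.-1, V_ncols n) :=
  match n return 'M[R]_(n.-1, V_ncols n) with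
  | m.+1 =>
      match m return 'M[R]_(m.-1, V_ncols m) -> 'M[R]_(m, V_ncols m.+1) with
      | S (S (S (S _))) as m => fun Vm : 'M[R]_(m.-1, V_ncols m) =>
          row_mx (col_mx (0 : 'rV_(V_ncols m)) Vm)
                 (add_last_row (U_mx R m.+1)
                    (const_mx 1 - const_mx 1 *m U_mx R m.+1))
      | 3 => fun _ => \col_(i < 3) [:: 0; 2; -1]`_i
      | _ => fun _ => 0
      end (V_mx R m)
  | 0 => 0
  end.

Fixpoint O2_nrows (n : nat) : nat :=
  if n is m.+1 then (O2_nrows m + m)%N else 0%N.

Lemma O2_nrowsE (n : nat) : O2_nrows n = 'C(n, 2).
Proof. by elim: n => //= n ->; rewrite binS bin1. Qed.

Fixpoint O2_ncols (n : nat) : nat :=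
  match n with
  | S ((S (S (S (S _)))) as m) => (O2_ncols m + (m + V_ncols m.+1))%N
  | 4 => 7
  | _ => 0
  end.

Fixpoint O2_rec (R : realType) (n : nat) : 'M[R]_(O2_nrows n, O2_ncols n) :=
  match n return 'M[R]_(O2_nrows n, O2_ncols n) with
  | m.+1 =>
      match m return 'M[R]_(O2_nrows m, O2_ncols m) ->
                     'M[R]_(O2_nrows m.+1, O2_ncols m.+1) with
      | S (S (S (S _))) as m => fun Om : 'M[R]_(O2_nrows m, O2_ncols m) =>
          block_mx Om 0
                   0  (row_mx 1%:M (V_mx R m.+1))
      | 3 => fun _ =>
          row_mx (1%:M : 'M_6) (\col_(i < 6) [:: 0; 0; 0; 0; 2; -1]`_i)
      | _ => fun _ => 0
      end (O2_rec R m)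
  | 0 => 0
  end.

Definition O2_mx (R : realType) (n : nat) : 'M[R]_('C(n, 2), O2_ncols n) :=
  castmx (O2_nrowsE n, erefl _) (O2_rec R n).

(* Main.v *)
Require Import Defs.
From mathcomp Require Import boolp classical_sets reals convex numfun.
From mathcomp Require Import interval_inference.
From mathcomp Require Import all_boot all_order perm all_algebra.
From mathcomp Require Import ring lra zify.

(** A rank 2 matroid is given by its loops and its parallel classes, and its
    base polytope is cut out of the simplex [x >= 0], [sum x = 2], [x = 0] on
    the loops, by [x(P) <= 1] for each class [P].  As the total is 2, at most one
    of these constraints fails at a time, so that the indicator function of the
    polytope is a linear combination of those of the matroids with the same loops
    and a single nontrivial class, which are isomorphic to Schubert matroids.  The
    expansion thus counts the classes by size, and the possible counts are the
    solutions [u] of [sum p u_p <= m], [m] being the number of nonloops; up to the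
    solutions with at most one class of size at least 2, which give unit vectors,
    they are listed by [V(m)].  So the points [o_M] are exactly the columns of the
    matrix, given that the expansion is unique.  Uniqueness holds since the
    complementary constraints [x(P) <= 1] and [x(Q) <= 1] are both tight at some
    points where moving a small weight to [P] violates only the first one. *)

Set Implicit Arguments.
Unset Strict Implicit.
Unset Printing Implicit Defensive.

Import Order.TTheory GRing.Theory Num.Theory.

Local Open Scope ring_scope.

Lemma sum_pred1 (R : pzRingType) (I : finType) (P : pred I) (l : I) :
  \sum_(k | P k) ((k == l)%:R : R) = (P l)%:R.
Proof.
case Pl: (P l).
  by rewrite (bigD1 l)//= eqxx big1 ?addr0// => k /andP[_ /negbTE->].
by rewrite big1// => k Pk; case: eqVneq => // kl; rewrite -kl Pk in Pl.
Qed.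

(** * Convex combinations with a real parameter *)

Section Convexity.
Variables (R : realType) (m : nat).
Implicit Types (K : set 'cV[R]_m) (x y : 'cV[R]_m).

(** [convex_set] quantifies over a bundled element of the unit interval. This lemma and the converse
    below trade it for a real number with two bounds. *)
Lemma convex_set_comb K x y (t : R) : convex_set K -> K x -> K y ->
  0 <= t -> t <= 1 -> K (t *: x + (1 - t) *: y).
Proof.
move=> cK Kx Ky t0 t1.
have t01 : Itv.spec (@Itv.num_sem R) (Itv.Real `[0%Z, 1%Z]) t.
  by rewrite /Itv.spec /Itv.num_sem /= in_itv/= t0 t1 num_real.
have := cK x y (Itv.mk t01); rewrite !in_setE => /(_ Kx Ky).
by [].
Qed.

Lemma convex_set_combP K : (forall x y (t : R), K x -> K y ->
  0 <= t -> t <= 1 -> K (t *: x + (1 - t) *: y)) -> convex_set K.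
Proof.
move=> cK x y t; rewrite !in_setE => Kx Ky.
exact: (cK x y t%:num Kx Ky).
Qed.

End Convexity.

(** * Rank 2 matroids as colorings *)

Section Coloring.
Variables (n : nat) (C : finType) (col : 'I_n -> option C).

(** A rank 2 matroid is coded by its loops, of color [None], and by its
    parallel classes, which are the other color classes. *)
Definition col_bases : {set {set 'I_n}} :=
  [set [set b.1; b.2] | b : 'I_n * 'I_n
     & [&& isSome (col b.1), isSome (col b.2) & col b.1 != col b.2]].

Lemma col_basesP B :
  reflect (exists i j, [/\ col i, col j, col i != col j & B = [set i; j]])
          (B \in col_bases).
Proof.
apply: (iffP imsetP) => [[[i j]]|[i [j [ci cj cij ->]]]].
  by rewrite inE/= => /and3P[ci cj cij] ->; exists i, j.
by exists (i, j); rewrite // inE/= ci cj.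
Qed.

End Coloring.

(** * The inequalities of the base polytope *)

Section Polytope.
Variables (R : realType) (n : nat) (C : finType) (col : 'I_n -> option C).
Implicit Types x y : 'cV[R]_n.

Definition col_polytope x :=
  [/\ forall i, 0 <= x i 0, \sum_i x i 0 = 2,
      forall i, col i = None -> x i 0 = 0
    & forall c, \sum_(i | col i == Some c) x i 0 <= 1].

Lemma col_polytope_le1 x i : col_polytope x -> x i 0 <= 1.
Proof.
case=> x0 _ xN xc; case ci: (col i) => [c|]; last by rewrite xN.
rewrite (le_trans _ (xc c))// (bigD1 i) ?ci//= lerDl sumr_ge0//.
Qed.

Definition shift x (i j : 'I_n) (a : R) : 'cV[R]_n :=
  \col_k (x k 0 + a * ((k == i)%:R - (k == j)%:R)).

Lemma sum_shift (P : pred 'I_n) x i j a :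
  \sum_(k | P k) shift x i j a k 0 =
  \sum_(k | P k) x k 0 + a * ((P i)%:R - (P j)%:R).
Proof.
under eq_bigr do rewrite mxE.
by rewrite big_split/= -mulr_sumr sumrB !sum_pred1.
Qed.

(** The most that can be moved from [j] to [i] within the unit cube: after this move [j] has
    coordinate 0 or [i] has coordinate 1. *)
Definition slack x (i j : 'I_n) := Num.min (x j 0) (1 - x i 0).

Definition fractional x := [set i | (0 < x i 0) && (x i 0 < 1)].

(** A move inside a class keeps its sum. A move between classes raises the sum of the class of [i],
    but there [i] carries the whole weight, so the bound 1 on its coordinate bounds the class. *)
Lemma shift_polytope x i j : col_polytope x -> i != j -> col i ->
  (forall c, col i = Some c -> col j != Some c ->
     \sum_(k | col k == Some c) x k 0 = x i 0) -> col j ->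
  col_polytope (shift x i j (slack x i j)).
Proof.
move=> Qx ij ci single cj; have xi1 := col_polytope_le1 i Qx.
have [x0 x2 xN xc] := Qx.
have a0 : 0 <= slack x i j by rewrite le_min x0 subr_ge0.
have aj : slack x i j <= x j 0 by rewrite ge_min lexx.
have ai : slack x i j <= 1 - x i 0 by rewrite ge_min lexx orbT.
split=> [k||k|c].
- rewrite mxE; case: (eqVneq k j) => [->|kj].
    by rewrite eq_sym (negbTE ij)/= sub0r mulrN1 subr_ge0.
  by rewrite subr0 addr_ge0// mulr_ge0.
- by rewrite sum_shift x2 subrr mulr0 addr0.
- move=> ck; rewrite mxE xN//.
  case: eqVneq => [ki|_]; first by rewrite -ki ck in ci.
  case: eqVneq => [kj|_]; first by rewrite -kj ck in cj.
  by rewrite subrr mulr0 addr0.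
- rewrite sum_shift; have := xc c; have := single c.
  case: (eqVneq (col i) (Some c)) => [->|_ _] /=; last first.
    rewrite sub0r mulrN => xc1; rewrite (le_trans _ xc1)// gerDl oppr_le0.
    by rewrite mulr_ge0.
  case: (eqVneq (col j) (Some c)) => [_ _|_ /(_ erefl isT) ->] /=.
    by rewrite subrr mulr0 addr0.
  by rewrite subr0 mulr1 => _; rewrite -lerBrDl.
Qed.

Lemma shift_fractional x i j : i != j -> i \in fractional x ->
  j \in fractional x ->
  (#|fractional (shift x i j (slack x i j))| < #|fractional x|)%N.
Proof.
move=> ij fi fj; apply/proper_card/properP.
have sub : {subset fractional (shift x i j (slack x i j)) <= fractional x}.
  move=> k; rewrite !inE mxE.
  case: (eqVneq k i) => [->|ki]; first by move: fi; rewrite inE => ->.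
  case: (eqVneq k j) => [->|kj]; first by move: fj; rewrite inE => ->.
  by rewrite subrr mulr0 addr0.
split; first exact/subsetP.
have [le|/ltW le] := leP (x j 0) (1 - x i 0).
  exists j => //; rewrite inE mxE eqxx eq_sym (negbTE ij) sub0r mulrN1.
  by rewrite /slack (min_l le) subrr ltxx.
exists i => //; rewrite inE mxE eqxx (negbTE ij) subr0 mulr1.
by rewrite /slack (min_r le) addrC subrK ltxx andbF.
Qed.

(** The two opposite moves, by [a] and by [b], average to [x] with weights [b / (a + b)] and
    [a / (a + b)]. *)
Lemma shift_mem K x i j : convex_set K -> i != j -> i \in fractional x ->
  j \in fractional x -> K (shift x i j (slack x i j)) ->
  K (shift x j i (slack x j i)) -> K x.
Proof.
rewrite !inE => cK ij /andP[xi0 xi1] /andP[xj0 xj1].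
set a := slack x i j; set b := slack x j i => Ka Kb.
have a0 : 0 < a by rewrite lt_min xj0 subr_gt0.
have b0 : 0 < b by rewrite lt_min xi0 subr_gt0.
have ab0 : a + b != 0 by rewrite gt_eqF// addr_gt0.
have t0 : 0 <= b / (a + b) by rewrite divr_ge0 ?addr_ge0// ltW.
have t1 : b / (a + b) <= 1.
  by rewrite ler_pdivrMr ?addr_gt0// mul1r lerDr ltW.
have := convex_set_comb cK Ka Kb t0 t1; congr K.
by apply/matrixP => k l; rewrite !mxE (ord1 l); field.
Qed.

Definition indic_col (B : {set 'I_n}) : 'cV[R]_n := \col_i (i \in B)%:R.

(** The coordinates are 0 or 1 with total 2, so exactly two are 1; they lie in different classes
    because a class has sum at most 1. *)
Lemma col_polytope_vertex x : col_polytope x ->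
  (forall i, i \notin fractional x) ->
  exists2 B, B \in col_bases col & x = indic_col B.
Proof.
move=> Qx nf; have [x0 x2 xN xc] := Qx.
have x01 i : x i 0 = (x i 0 == 1)%:R.
  case: eqP => [//|/eqP xi1] /=; have := nf i; rewrite inE.
  rewrite (lt_neqAle _ 1) xi1 col_polytope_le1// !andbT -leNgt => xi0.
  by apply/eqP; rewrite eq_le xi0 x0.
pose B := [set i | x i 0 == 1].
have cB : #|B| = 2%N.
  apply/eqP; rewrite -(eqr_nat R) -x2; under [in eqbRHS]eq_bigr do rewrite x01.
  by rewrite -natr_sum -sum1dep_card big_mkcond /=; apply/eqP; congr _%:R;
     apply: eq_bigr => i _; case: eqP.
have /cards2P[i [j [ij BE]]] : #|B| == 2%N by rewrite cB.
have xB k : k \in B -> x k 0 = 1 by rewrite inE => /eqP.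
have xi : x i 0 = 1 by apply: xB; rewrite BE !inE eqxx.
have xj : x j 0 = 1 by apply: xB; rewrite BE !inE eqxx orbT.
exists B; last by apply/matrixP => k l; rewrite (ord1 l) !mxE x01 inE.
apply/col_basesP; exists i, j; split => //.
- by case ci: (col i) => //; move: xi; rewrite xN// => /eqP; rewrite eq_sym oner_eq0.
- by case cj: (col j) => //; move: xj; rewrite xN// => /eqP; rewrite eq_sym oner_eq0.
apply/eqP => cij; case ci: (col i) => [c|]; last first.
  by move: xi; rewrite xN// => /eqP; rewrite eq_sym oner_eq0.
have := xc c; rewrite (bigD1 i) ?ci//= (bigD1 j)/=; last first.
  by rewrite -cij ci eqxx eq_sym.
rewrite xi xj addrA leNgt (@lt_le_trans _ _ (1 + 1))//; first by rewrite ltrDl.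
by rewrite lerDl sumr_ge0.
Qed.

(** By induction on the number of fractional coordinates, writing [x] as an average of two shifted
    points. If two positive coordinates share a class, weight is moved between them; otherwise each
    class carries its weight on one element, and any two fractional coordinates will do. *)
Lemma col_polytope_sub K : convex_set K ->
  (forall B, B \in col_bases col -> K (indic_col B)) ->
  forall x, col_polytope x -> K x.
Proof.
move=> cK KB x; have [k] := ubnP #|fractional x|.
elim: k x => // k IH x; rewrite ltnS => fk Qx; have [x0 x2 xN xc] := Qx.
have nl i : i \in fractional x -> col i.
  rewrite inE => /andP[xi0 _]; case ci: (col i) => //.
  by rewrite xN// ltxx in xi0.
have step i j : i != j -> i \in fractional x -> j \in fractional x ->
    (forall c, col i = Some c -> col j != Some c ->
       \sum_(k | col k == Some c) x k 0 = x i 0) ->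
    (forall c, col j = Some c -> col i != Some c ->
       \sum_(k | col k == Some c) x k 0 = x j 0) -> K x.
  move=> ij fi fj Hi Hj; have ji : j != i by rewrite eq_sym.
  apply: (shift_mem cK ij fi fj).
    apply: IH; first exact: leq_trans (shift_fractional ij fi fj) fk.
    by apply: shift_polytope => //; exact: nl.
  apply: IH; first exact: leq_trans (shift_fractional ji fj fi) fk.
  by apply: shift_polytope => //; exact: nl.
have fracI i j : i != j -> 0 < x i 0 -> 0 < x j 0 -> col i = col j ->
    i \in fractional x.
  move=> ij xi xj cij; rewrite inE xi/=; case ci: (col i) => [c|]; last first.
    by rewrite xN// ltxx in xi.
  rewrite (lt_le_trans _ (xc c))// (bigD1 i) ?ci//= (bigD1 j)/=.
    by rewrite ltrDl ltr_wpDr// sumr_ge0.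
  by rewrite -cij ci eqxx eq_sym.
have [/existsP[i /existsP[j /and4P[ij xi xj /eqP cij]]]|nsame] :=
  boolP [exists i, exists j, [&& i != j, 0 < x i 0, 0 < x j 0 & col i == col j]].
  apply: (step i j) => //.
  - exact: fracI ij xi xj cij.
  - by apply: (fracI j i) => //; rewrite eq_sym.
  - by move=> c ci; rewrite -cij ci eqxx.
  - by move=> c cj; rewrite cij cj eqxx.
have single i c : i \in fractional x -> col i = Some c ->
    \sum_(k | col k == Some c) x k 0 = x i 0.
  move=> fi ci; rewrite (bigD1 i) ?ci//= big1 ?addr0// => j /andP[/eqP cj ji].
  apply/eqP; rewrite eq_le x0 andbT leNgt; apply: contra nsame => xj.
  apply/existsP; exists j; apply/existsP; exists i.
  by rewrite ji xj cj ci eqxx andbT; move: fi; rewrite inE => /andP[].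
have [i fi|nf] := pickP (mem (fractional x)); last first.
  have [|B BB ->] := col_polytope_vertex Qx; last exact: KB.
  by move=> i; have := nf i; rewrite inE => ->.
have [j /andP[/= fj ij]|nf0] := pickP [pred j in fractional x | i != j].
  by apply: (step i j) => // c cc _; apply: single.
(* Here [i] is the only fractional coordinate, which is absurd as the total 2 and the other
   coordinates are integers. *)
have xint j : j != i -> x j 0 = (x j 0 == 1)%:R.
  move=> ji; case: eqP => [//|/eqP xj1] /=.
  have := nf0 j; rewrite inE /= eq_sym ji andbT inE.
  rewrite (lt_neqAle _ 1) xj1 col_polytope_le1// !andbT => /negbT.
  by rewrite -leNgt => xj0; apply/eqP; rewrite eq_le xj0 x0.
move: fi; rewrite !inE => /andP[xi0 xi1].
pose one j := x j 0 == 1.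
have : x i 0 + (\sum_(j | j != i) one j)%N%:R = 2.
  rewrite -x2 [RHS](bigD1 i)//= natr_sum; congr (_ + _).
  by apply: eq_bigr => j /xint ->; rewrite /one; case: eqP.
move: (\sum_(j | _) _)%N => N e.
have NE : (N%:R : R) = 2 - x i 0 by rewrite -e [x i 0 + _]addrC addrK.
have N1 : (1%:R : R) < N%:R by rewrite NE; lra.
have N2 : (N%:R : R) < 2%:R by rewrite NE; lra.
by move: N1 N2; rewrite !ltr_nat; case: N {e NE} => [|[|]].
Qed.

Lemma col_polytope_convex : convex_set (col_polytope : set 'cV[R]_n).
Proof.
apply: convex_set_combP => x y t [x0 x2 xN xc] [y0 y2 yN yc] t0 t1.
have t1' : 0 <= 1 - t by rewrite subr_ge0.
have sumE (P : pred 'I_n) : \sum_(i | P i) (t *: x + (1 - t) *: y) i 0 =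
    t * \sum_(i | P i) x i 0 + (1 - t) * \sum_(i | P i) y i 0.
  by rewrite !mulr_sumr -big_split; apply: eq_bigr => i _; rewrite !mxE.
split=> [i||i ci|c].
- by rewrite !mxE addr_ge0// mulr_ge0.
- by rewrite sumE x2 y2 -mulrDl addrC subrK mul1r.
- by rewrite !mxE xN// yN// !mulr0 addr0.
- rewrite sumE -[leRHS](subrK t) addrC.
  by rewrite lerD// ler_piMr.
Qed.

Lemma col_base_polytopeE :
  base_polytope (col_bases col) = col_polytope :> set 'cV[R]_n.
Proof.
apply/seteqP; split=> x.
  apply: smallest_sub; first exact: col_polytope_convex.
  move=> _ [B /= /col_basesP[i [j [ci cj cij ->]]] <-].
  have ij : i != j by apply: contra cij => /eqP ->.
  have sumB (P : pred 'I_n) : \sum_(k | P k) (\col_l (l \in [set i; j])%:R) k 0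
      = (P i)%:R + (P j)%:R :> R.
    rewrite -!sum_pred1 -big_split; apply: eq_bigr => k _; rewrite !mxE !inE.
    case: (eqVneq k i) => [->|_]; first by rewrite (negbTE ij)/= addr0.
    by rewrite /= add0r.
  split=> [k||k ck|c].
  - by rewrite mxE ler0n.
  - by rewrite sumB.
  - rewrite mxE !inE; case: eqVneq => [ki|_]; first by rewrite -ki ck in ci.
    by case: eqVneq => [kj|_]; first by rewrite -kj ck in cj.
  - rewrite sumB -natrD (ler_nat _ _ 1); case: eqP => [ei|_]; last by case: eqP.
    by case: eqP => // ej; rewrite ei ej eqxx in cij.
move=> Qx; move=> K [cK KB]; apply: col_polytope_sub Qx => // B BB.
by apply: KB; exists B.
Qed.

End Polytope.

(** * Colorings with two colors are the rank 2 matroids *)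

Section Matroid.
Variables (n : nat).

(** For the exchange, let [z] be the element of [A] that stays. The two elements of [B] have
    different colors, so one of them has a color other than that of [z]. *)
Lemma col_bases_matroid (C : finType) (col : 'I_n -> option C) i j :
  col i -> col j -> col i != col j -> is_matroid 2 (col_bases col).
Proof.
move=> ci cj cij; split.
- by apply/set0Pn; exists [set i; j]; apply/col_basesP; exists i, j.
- move=> B /col_basesP[a [b [_ _ cab ->]]]; rewrite cards2.
  by case: (eqVneq a b) cab => // ->; rewrite eqxx.
move=> A B x /col_basesP[a [a' [ca ca' caa AE]]] /col_basesP[b [b' [cb cb' cbb BE]]].
rewrite !inE => /andP[xB xA].
have [z [cz AE' zx]] : exists z, [/\ col z, A :\ x = [set z] & z != x].
  have aa : a != a' by apply: contra caa => /eqP ->.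
  have {xA} : (x == a) || (x == a') by rewrite AE !inE in xA.
  case/orP => /eqP xE.
    exists a'; split => //; last by rewrite xE eq_sym.
    rewrite AE xE; apply/setP => k; rewrite !inE.
    by case: (eqVneq k a') => [->|_]; rewrite ?orbF ?orbT ?andbT ?andNb// eq_sym.
  exists a; split => //; last by rewrite xE.
  rewrite AE xE; apply/setP => k; rewrite !inE.
  by case: (eqVneq k a) => [->|_]; rewrite /= ?andbT ?andNb.
have [y [yB cy cyz]] : exists y, [/\ y \in B, col y & col y != col z].
  have [bz|bz] := eqVneq (col b) (col z).
    by exists b'; rewrite BE !inE eqxx orbT; split=> //; rewrite -bz eq_sym.
  by exists b; rewrite BE !inE eqxx.
have yx : y != x by apply: contra xB => /eqP <-.
have yz : y != z by apply: contra cyz => /eqP ->.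
exists y.
  rewrite inE yB andbT; apply/negP => yA.
  have : y \in A :\ x by rewrite !inE yx.
  by rewrite AE' inE (negbTE yz).
by rewrite AE'; apply/col_basesP; exists y, z.
Qed.

(** On the nonloops, not forming a base is an equivalence relation, namely parallelism; its classes
    are the colors. *)
Lemma matroid_coloring (Bs : {set {set 'I_n}}) : is_matroid 2 Bs ->
  exists2 col : 'I_n -> option 'I_n, Bs = col_bases col &
    exists i j, [/\ col i, col j & col i != col j].
Proof.
move=> [Bs0 card2 exch].
pose nonloop i := [exists j, [set i; j] \in Bs].
have diag i : [set i; i] \notin Bs.
  by apply/negP => /card2; rewrite cards2 eqxx.
(* Take a base [[set j; y]]. If [[set i; k]] were a base, exchanging [y] against it would give a
   base made of [j] and one of [i], [k]. *)
have trans i j k : [set i; j] \notin Bs -> [set j; k] \notin Bs ->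
    nonloop j -> [set i; k] \notin Bs.
  move=> ij jk /existsP[y jy]; apply/negP => ik.
  have yij : y != j by apply: contraTN jy => /eqP ->.
  have [yik|yik] := boolP (y \in [set i; k]).
    move: yik jy; rewrite !inE => /orP[] /eqP ->; last exact/negP.
    by rewrite setUC; exact/negP.
  have yD : y \in [set j; y] :\: [set i; k] by rewrite in_setD yik !inE eqxx orbT.
  have [z zD] := exch _ _ _ jy ik yD.
  have -> : [set j; y] :\ y = [set j].
    apply/setP => l; rewrite !inE.
    by case: (eqVneq l y) => [->|_]; rewrite /= ?(negbTE yij) ?orbF.
  move: zD; rewrite !inE => /andP[_ /orP[] /eqP ->]; first exact/negP.
  by rewrite setUC; exact/negP.
pose mates i := [pred j | nonloop j && ([set i; j] \notin Bs)].
(* A class is named by the element that [pick] chooses in it; parallel elements have the same mates,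
   hence the same choice. *)
pose col i := if nonloop i then [pick j in mates i] else None.
have colN i : isSome (col i) = nonloop i.
  rewrite /col; case: ifP => // ni; case: pickP => // /(_ i).
  by rewrite !inE ni diag.
have colE i j : nonloop i -> nonloop j ->
    (col i == col j) = ([set i; j] \notin Bs).
  move=> ni nj; apply/eqP/idP => [|ij].
    rewrite /col ni nj; case: pickP => [k|/(_ i)]; last by rewrite !inE ni diag.
    rewrite !inE => /andP[nk ik]; case: pickP => // k' + [kk].
    rewrite -{k'}kk !inE nk/= => jk.
    by apply: trans ik _ nk; rewrite setUC.
  rewrite /col ni nj; apply: eq_pick => k; rewrite !inE; case nk: (nonloop k) => //=.
  apply/idP/idP => [ik|jk]; last exact: trans ij jk nj.
  by apply: trans ik ni; rewrite setUC.
have pairP i j : [set i; j] \in Bs -> [/\ col i, col j & col i != col j].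
  move=> ij; have ni : nonloop i by apply/existsP; exists j.
  have nj : nonloop j by apply/existsP; exists i; rewrite setUC.
  by rewrite !colN colE// ij.
exists col.
  apply/setP => B; apply/idP/col_basesP => [BB|[i [j [ci cj cij ->]]]].
    have /eqP/cards2P[i [j [ij BE]]] := card2 _ BB.
    by exists i, j; rewrite BE in BB *; have [] := pairP _ _ BB.
  by rewrite colE -?colN// negbK in cij.
have /set0Pn[B BB] := Bs0.
have /eqP/cards2P[i [j [ij BE]]] := card2 _ BB.
by exists i, j; rewrite BE in BB; apply: pairP.
Qed.

End Matroid.

(** * Matroids with one nontrivial class, and Schubert matroids *)

Section PairPolytope.
Variables (R : realType) (n : nat).
Implicit Types (x y : 'cV[R]_n) (L P : {set 'I_n}).

(** The polytope of the matroid with loops [L], a parallel class [P], and no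
    other pair of parallel elements. *)
Definition pair_polytope L P : set 'cV[R]_n := fun x =>
  [/\ forall i, 0 <= x i 0 <= 1, \sum_i x i 0 = 2,
      forall i, i \in L -> x i 0 = 0 & \sum_(i in P) x i 0 <= 1].

Definition pair_col L P (i : 'I_n) : option (option 'I_n) :=
  if i \in L then None else if i \in P then Some None else Some (Some i).

(** The constraints of the singleton classes are the bounds [x i 0 <= 1]. *)
Lemma pair_polytopeE L P : [disjoint L & P] ->
  col_polytope (pair_col L P) = pair_polytope L P.
Proof.
move=> LP; apply/seteqP; split=> x.
  move=> Qx; have [x0 x2 xN xc] := Qx; split=> [i||i iL|] //.
  - by rewrite x0 (col_polytope_le1 _ Qx).
  - by apply: xN; rewrite /pair_col iL.
  - apply: le_trans (xc None); rewrite le_eqVlt; apply/orP; left; apply/eqP.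
    apply: eq_bigl => i; rewrite /pair_col.
    case: ifP => [iL|_]; last by case: ifP.
    by rewrite (disjointFr LP iL).
move=> [x01 x2 xL xP]; split=> [i||i|[c|]] //.
- by have /andP[] := x01 i.
- by rewrite /pair_col; case: ifP => [/xL//|_]; case: ifP.
- apply: (@le_trans _ _ (x c 0)); last by have /andP[] := x01 c.
  rewrite [leRHS](_ : _ = \sum_(i | i == c) x i 0); last by rewrite big_pred1_eq.
  rewrite [leLHS]big_mkcond [leRHS]big_mkcond; apply: ler_sum => i _.
  rewrite /pair_col; have /andP[xi0 _] := x01 i.
  by case: (i \in L); [|case: (i \in P)] => //=; case: ifP.
- apply: le_trans xP; rewrite le_eqVlt; apply/orP; left; apply/eqP.
  apply: eq_bigl => i; rewrite /pair_col.
  case: ifP => [iL|_]; last by case: ifP.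
  by rewrite (disjointFr LP iL).
Qed.

(** This lets the polytope without any class constraint count as that of class size 1 in the
    expansions. *)
Lemma pair_polytope_set1 L i : pair_polytope L [set i] = pair_polytope L set0.
Proof.
apply/seteqP; split=> x [x01 x2 xL xP]; split=> //; first by rewrite big_set0.
by rewrite big_set1; have /andP[] := x01 i.
Qed.

Lemma pair_polytope_perm (s : 'S_n) L P L' P' x :
  (forall i, (s i \in L') = (i \in L)) -> (forall i, (s i \in P') = (i \in P)) ->
  pair_polytope L P (row_perm s x) <-> pair_polytope L' P' x.
Proof.
move=> sL sP.
have sumE (A A' : {set 'I_n}) : (forall i, (s i \in A') = (i \in A)) ->
    \sum_(i in A') x i 0 = \sum_(i in A) row_perm s x i 0.
  move=> sA; rewrite (reindex_inj (@perm_inj _ s)); apply: eq_big => // i _.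
  by rewrite mxE.
have sum2 : \sum_i x i 0 = \sum_i row_perm s x i 0.
  by rewrite (reindex_inj (@perm_inj _ s)); apply: eq_bigr => i _; rewrite mxE.
split=> -[x01 x2 xL xP]; split.
- by move=> i; have := x01 ((s^-1)%g i); rewrite mxE permKV.
- by rewrite sum2.
- move=> i iL'; have := xL ((s^-1)%g i); rewrite mxE permKV; apply.
  by rewrite -sL permKV.
- by rewrite (sumE _ _ sP).
- by move=> i; rewrite mxE.
- by rewrite -sum2.
- by move=> i iL; rewrite mxE; apply: xL; rewrite sL.
- by rewrite -(sumE _ _ sP).
Qed.

Lemma sym_indic_pair_polytope_perm (s : 'S_n) L P L' P' x :
  (forall i, (s i \in L') = (i \in L)) -> (forall i, (s i \in P') = (i \in P)) ->
  sym_indic (pair_polytope L P) x = sym_indic (pair_polytope L' P') x.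
Proof.
move=> sL sP; congr (_ * _); rewrite (reindex_inj (mulgI s)) /=.
apply: eq_bigr => t _; rewrite row_permM !indicE; congr (nat_of_bool _)%:R.
by apply/idP/idP; rewrite !in_setE => /(pair_polytope_perm _ sL sP).
Qed.

(** The loops and the parallel class of the Schubert matroid
    [S(l.+1, (l + p).+1)]. *)
Definition std_loops l : {set 'I_n} := [set i : 'I_n | (i < l)%N].
Definition std_class l p : {set 'I_n} := [set i : 'I_n | (l <= i < l + p)%N].

(** List [L], then [P], then the remaining elements; the permutation sends a position to the element
    found there. *)
Lemma std_perm L P : [disjoint L & P] -> exists s : 'S_n,
  (forall i, (s i \in L) = (i \in std_loops #|L|)) /\
  (forall i, (s i \in P) = (i \in std_class #|L| #|P|)).
Proof.
move=> LP; pose sq := enum L ++ enum P ++ enum (~: (L :|: P)).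
have LPF i : i \in P -> i \in L -> False by move=> iP; rewrite (disjointFl LP iP).
have uq : uniq sq.
  rewrite !cat_uniq !enum_uniq /= has_cat negb_or !andbT -andbA.
  apply/and3P; split; apply/hasPn => i; rewrite !mem_enum.
  - by move=> iP; apply/negP => /(LPF _ iP).
  - by rewrite !inE negb_or => /andP[].
  - by rewrite !inE negb_or => /andP[].
have sz : size sq = n.
  rewrite !size_cat -!cardE addnA.
  have : #|L :|: P| = (#|L| + #|P|)%N.
    by rewrite cardsU disjoint_setI0// cards0 subn0.
  by move=> <-; rewrite cardsC card_ord.
have sz' i : (nat_of_ord (i : 'I_n) < size sq)%N by rewrite sz.
have inj : injective (fun i : 'I_n => nth i sq i).
  move=> i j; rewrite (set_nth_default j) // => /eqP.
  by rewrite nth_uniq // => /eqP /val_inj.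
exists (perm inj); split=> i; rewrite permE !inE.
  rewrite nth_cat -cardE; case: ltnP => iL.
    by rewrite -mem_enum mem_nth -?cardE.
  have := sz' i; rewrite size_cat -cardE => isz.
  have : nth i (enum P ++ enum (~: (L :|: P))) (i - #|L|) \in
     enum P ++ enum (~: (L :|: P)) by apply: mem_nth; rewrite ltn_subLR.
  rewrite mem_cat !mem_enum !inE negb_or => /orP[iP|/andP[/negbTE->]//].
  by apply/negP => /(LPF _ iP).
rewrite nth_cat -cardE; case: ltnP => iL /=.
  apply/negP => iP; apply: (LPF _ iP); rewrite -mem_enum mem_nth//.
  by rewrite -cardE.
rewrite nth_cat -cardE ltn_subLR//; case: ltnP => iP /=.
  by rewrite -mem_enum mem_nth// -cardE ltn_subLR// leq_subRL.
have : nth i (enum (~: (L :|: P))) (i - #|L| - #|P|) \in enum (~: (L :|: P)).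
  have := sz' i; rewrite !size_cat -!cardE => isz.
  by apply: mem_nth; rewrite -cardE -subnDA ltn_subLR// -addnA.
by rewrite mem_enum !inE negb_or => /andP[_ /negbTE].
Qed.

Definition schubert_indic l p x :=
  sym_indic (pair_polytope (std_loops l) (std_class l p)) x.

Lemma sym_indic_pair_polytope L P x : [disjoint L & P] ->
  sym_indic (pair_polytope L P) x = schubert_indic #|L| #|P| x.
Proof.
by move=> /std_perm[s [sL sP]]; apply/esym/(sym_indic_pair_polytope_perm _ sL sP).
Qed.

(** For nonloops [i < j], the pair fails to be a base exactly when [j < l + p], that is, when both
    lie in the class. *)
Lemma schubert2E l p : (0 < p)%N -> (l + p < n)%N ->
  schubert2 n l.+1 (l + p).+1 = col_bases (pair_col (std_loops l) (std_class l p)).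
Proof.
move=> p0 lpn; apply/setP => B; apply/imsetP/col_basesP.
  move=> [[i j]]; rewrite inE /= !ltnS => /and3P[ij li lpj] ->.
  exists i, j; split => //; rewrite /pair_col !inE.
  - by rewrite ltnNge li /=; case: ifP.
  - by rewrite ltnNge (leq_trans (leq_addr _ _) lpj) /=; case: ifP.
  - rewrite !ltnNge li lpj (leq_trans (leq_addr _ _) lpj) /=.
    case: ifP => // _; apply/eqP => -[ijE].
    by rewrite ijE ltnn in ij.
move=> [i [j]]; wlog ij : i j / (i < j)%N => [hw|].
  move=> [ci cj cij BE].
  have [ij|ji|/val_inj ij] := ltngtP i j.
  - by apply: (hw i j).
  - by apply: (hw j i); rewrite // setUC; split; rewrite // eq_sym.
  - by rewrite ij eqxx in cij.
move=> [ci cj cij ->]; exists (i, j) => //; rewrite inE /= ij !ltnS /=.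
move: ci cj cij; rewrite /pair_col !inE.
case: ltnP => //= li _; case: ltnP => //= lj; case: ltnP => //= lpj _.
by case: ifP => //; lia.
Qed.

Lemma sym_indic_schubert2 l p x : (0 < p)%N -> (l + p < n)%N ->
  sym_indic (base_polytope (schubert2 n l.+1 (l + p).+1)) x = schubert_indic l p x.
Proof.
move=> p0 lpn; rewrite schubert2E// col_base_polytopeE pair_polytopeE//.
by rewrite -setI_eq0; apply/eqP/setP => i; rewrite !inE; lia.
Qed.

End PairPolytope.

(** * Existence of the Schubert expansion *)

Section Expansion.
Variables (R : realType) (n : nat) (C : finType) (col : 'I_n -> option C).
Implicit Types x y : 'cV[R]_n.

Definition col_loops : {set 'I_n} := [set i | col i == None].
Definition col_class c : {set 'I_n} := [set i | col i == Some c].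

Lemma sum_col_class x c :
  \sum_(i in col_class c) x i 0 = \sum_(i | col i == Some c) x i 0.
Proof. by apply: eq_bigl => i; rewrite inE. Qed.

Lemma col_polytope_pair_polytope x : col_polytope col x <->
  pair_polytope col_loops set0 x /\ forall c, \sum_(i in col_class c) x i 0 <= 1.
Proof.
split=> [Qx|[[x01 x2 xL _] xc]].
  have [x0 x2 xN xc] := Qx; split; last by move=> c; rewrite sum_col_class.
  split=> //; last by rewrite big_set0.
  - by move=> i; rewrite x0 (col_polytope_le1 _ Qx).
  - by move=> i; rewrite inE => /eqP /xN.
split=> // [i|i ci|c].
- by have /andP[] := x01 i.
- by apply: xL; rewrite inE ci.
- by rewrite -sum_col_class.
Qed.

Lemma pair_polytope_sub0 (L P : {set 'I_n}) x : pair_polytope L P x <->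
  pair_polytope L set0 x /\ \sum_(i in P) x i 0 <= 1.
Proof.
split=> [[x01 x2 xL xP]|[[x01 x2 xL _] xP]]; last by split.
by split=> //; split=> //; rewrite big_set0.
Qed.

(** In the hypersimplex at most one class can have sum larger than 1, as the
    total is 2. *)
Lemma indic_col_polytope x :
  \1_(col_polytope col) x =
  \sum_(c | col_class c != set0) \1_(pair_polytope col_loops (col_class c)) x
  + (1 - #|[set c | col_class c != set0]|%:R) * \1_(pair_polytope col_loops set0) x :> R.
Proof.
have [hx|nhx] := pselect (pair_polytope col_loops set0 x); last first.
  have nmem (X : set 'cV[R]_n) : (X `<=` pair_polytope col_loops set0)%classic ->
      \1_X x = 0 :> R.
    by move=> sX; rewrite indicE memNset// => /sX.
  rewrite !nmem// ?mulr0 ?addr0; last by move=> y /col_polytope_pair_polytope[].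
  by rewrite big1// => c _; rewrite nmem// => y /pair_polytope_sub0[].
have -> : \1_(pair_polytope col_loops set0) x = 1 :> R by rewrite indicE mem_set.
pose b c := \sum_(i in col_class c) x i 0 <= 1.
have -> : \1_(col_polytope col) x = [forall c, b c]%:R :> R.
  rewrite indicE; congr (nat_of_bool _)%:R; apply/idP/forallP.
    by rewrite in_setE => /col_polytope_pair_polytope[].
  by move=> bc; rewrite in_setE; apply/col_polytope_pair_polytope.
under eq_bigr => c _.
  rewrite (_ : \1_ _ x = (b c)%:R); last first.
    rewrite indicE; congr (nat_of_bool _)%:R; apply/idP/idP.
      by rewrite in_setE => /pair_polytope_sub0[].
    by move=> bc; rewrite in_setE; apply/pair_polytope_sub0.
  over.
rewrite mulr1 -sum1dep_card natr_sum.
(* With [k] nonempty classes the right side is [k + (1 - k) = 1] if no constraint fails, and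
   [(k - 1) + (1 - k) = 0] if exactly one does. *)
have [/forallP bc|] := boolP [forall c, b c].
  by under eq_bigr do rewrite bc; rewrite addrCA subrr addr0.
move=> /forallPn[c0]; rewrite /b -ltNge => sc0.
have c0n : col_class c0 != set0.
  by apply: contraTneq sc0 => ->; rewrite big_set0 -leNgt ler01.
have bc c : c != c0 -> b c.
  move=> cc0; have [x01 x2 _ _] := hx.
  have x0 i : 0 <= x i 0 by have /andP[] := x01 i.
  have : \sum_(i in col_class c) x i 0 + \sum_(i in col_class c0) x i 0 <= 2.
    rewrite -x2 [leRHS](bigID (mem (col_class c)))/= lerD2l.
    rewrite [leRHS](bigID (mem (col_class c0)))/=.
    rewrite [\sum_(i | _ && (i \in col_class c0)) _](_ : _ =
      \sum_(i in col_class c0) x i 0) ?lerDl ?sumr_ge0//.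
    apply: eq_bigl => i; rewrite !inE andbC; case: eqP => //= ->.
    by apply/eqP => -[e]; rewrite e eqxx in cc0.
  by rewrite /b; move: (\sum_(_ in _) _) (\sum_(_ in col_class c0) _) sc0 => s t; lra.
rewrite (bigD1 c0)//= [X in 1 - X](bigD1 c0)//= /b leNgt sc0 /=.
rewrite (eq_bigr (fun=> 1)); last by move=> c /andP[_ /bc]; rewrite /b => ->.
by ring.
Qed.

Lemma sym_indic_linear (I : finType) (P : pred I) (X Z : set 'cV[R]_n)
    (Y : I -> set 'cV[R]_n) (a : R) :
  (forall x, \1_X x = \sum_(c | P c) \1_(Y c) x + a * \1_Z x) ->
  forall x, sym_indic X x = \sum_(c | P c) sym_indic (Y c) x + a * sym_indic Z x.
Proof.
move=> XYZ x; rewrite /sym_indic -mulr_sumr mulrCA -mulrDr; congr (_ * _).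
under eq_bigr do rewrite XYZ.
by rewrite big_split/= exchange_big/= mulr_sumr.
Qed.

Definition num_classes p : nat := #|[set c | #|col_class c| == p]|.

(** The Schubert expansion of the matroid with [u p] parallel classes of size
    [p], on [m] elements which are not loops. *)
Definition coef (m : nat) (u : nat -> nat) (p : nat) : R :=
  if p == 1%N then 1 - (\sum_(2 <= q < m) u q)%N%:R else (u p)%:R.

(** Since two colors occur, every class misses a nonloop. Class sizes thus stay in the range of the
    Schubert matroids with the same number of loops. *)
Lemma col_class_size i j c : col i -> col j -> col i != col j ->
  (#|col_class c| < n - #|col_loops|)%N.
Proof.
move=> ci cj cij.
have -> : (n - #|col_loops|)%N = #|~: col_loops|.
  by rewrite -[X in (X - _)%N]card_ord -(cardsC col_loops) addKn.
apply/proper_card/properP; split.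
  by apply/subsetP => k; rewrite !inE => /eqP ->.
have [cE|cN] := eqVneq (col i) (Some c).
  by exists j; rewrite !inE; [case: (col j) cj | rewrite -cE eq_sym].
by exists i; rewrite !inE //; case: (col i) ci.
Qed.

Lemma sum_classes (m : nat) (F : nat -> R) :
  (forall c, (#|col_class c| < m)%N) ->
  \sum_(c | col_class c != set0) F #|col_class c| =
  \sum_(1 <= p < m) (num_classes p)%:R * F p.
Proof.
move=> cm; rewrite big_mkcond; under [RHS]eq_bigr => p _.
  by rewrite /num_classes -sum1dep_card natr_sum mulr_suml; over.
rewrite (exchange_big_dep xpredT)//=; apply: eq_bigr => c _.
under [RHS]eq_bigr do rewrite mul1r.
under [RHS]eq_bigl do rewrite eq_sym.
by rewrite big_nat1_eq cm andbT card_gt0.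
Qed.

(** The coefficient at size 1 absorbs the multiple of the unconstrained polytope: one minus the
    number of classes of size at least 2 is [u 1] plus one minus the number of all classes. *)
Lemma big_nat_coef (m : nat) (u : nat -> nat) (F : nat -> R) : (1 < m)%N ->
  \sum_(1 <= p < m) coef m u p * F p =
  \sum_(1 <= p < m) (u p)%:R * F p + (1 - (\sum_(1 <= p < m) u p)%N%:R) * F 1%N.
Proof.
move=> m1; rewrite !(@big_ltn _ _ _ 1)// {1}/coef eqxx.
rewrite (_ : \sum_(2 <= p < m) coef m u p * F p =
  \sum_(2 <= p < m) (u p)%:R * F p); last first.
  by apply: eq_big_nat => p /andP[p1 _]; rewrite /coef gtn_eqF.
by rewrite natrD; ring.
Qed.

Lemma card_classes (m : nat) : (forall c, (#|col_class c| < m)%N) ->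
  #|[set c | col_class c != set0]| = (\sum_(1 <= p < m) num_classes p)%N.
Proof.
move=> cm; apply/eqP; rewrite -(eqr_nat R) -sum1dep_card !natr_sum.
rewrite (sum_classes (fun=> 1) cm).
by apply/eqP/eq_bigr => p _; rewrite mulr1.
Qed.

Lemma sym_indic_col x i j : col i -> col j -> col i != col j ->
  sym_indic (base_polytope (col_bases col)) x =
  \sum_(1 <= p < n - #|col_loops|)
     coef (n - #|col_loops|) num_classes p * schubert_indic #|col_loops| p x.
Proof.
move=> ci cj cij; set l := #|col_loops|; set m := (n - l)%N.
have cm c : (#|col_class c| < m)%N := col_class_size c ci cj cij.
have m1 : (1 < m)%N.
  case E: (col i) ci => [c|//] _; apply: leq_ltn_trans (cm c).
  by rewrite card_gt0; apply/set0Pn; exists i; rewrite inE E.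
have dis c : [disjoint col_loops & col_class c].
  by rewrite -setI_eq0; apply/eqP/setP => k; rewrite !inE; case: eqP => // ->.
rewrite col_base_polytopeE (sym_indic_linear indic_col_polytope) big_nat_coef//.
rewrite (eq_bigr (fun c => schubert_indic l #|col_class c| x)); last first.
  by move=> c _; exact: sym_indic_pair_polytope.
rewrite (sum_classes (fun p => schubert_indic l p x) cm) (card_classes cm).
congr (_ + _ * _).
have iL : i \notin col_loops by rewrite inE; case: (col i) ci.
rewrite -(@pair_polytope_set1 R n _ i) sym_indic_pair_polytope ?cards1//.
by rewrite disjoint_sym disjoints1.
Qed.

End Expansion.

(** * Uniqueness of the Schubert expansion *)

Section Independence.
Variables (R : realType) (n : nat).
Implicit Types x y : 'cV[R]_n.

Lemma sym_indic_le (X Y : set 'cV[R]_n) x y :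
  (forall s : 'S_n, X (row_perm s x) -> Y (row_perm s y)) ->
  sym_indic X x <= sym_indic Y y.
Proof.
move=> XY; apply: ler_wpM2l; first by rewrite invr_ge0.
apply: ler_sum => s _; rewrite !indicE ler_nat.
case: (boolP (_ \in X)) => //; rewrite in_setE => /XY Ys.
by rewrite mem_set.
Qed.

(** The term of the identity permutation makes the inequality strict. *)
Lemma sym_indic_lt (X Y : set 'cV[R]_n) x y :
  (forall s : 'S_n, X (row_perm s x) -> Y (row_perm s y)) ->
  ~ X x -> Y y -> sym_indic X x < sym_indic Y y.
Proof.
move=> XY Xx Yy; rewrite /sym_indic ltr_pM2l ?invr_gt0 ?ltr0n ?fact_gt0//.
rewrite (bigD1 (1%g : 'S_n))//= [ltRHS](bigD1 (1%g : 'S_n))//= !row_perm1 !indicE.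
rewrite (memNset Xx) (mem_set Yy) ltr_leD ?ltr01//; apply: ler_sum => s _.
rewrite !indicE ler_nat; case: (boolP (_ \in X)) => //.
by rewrite in_setE => /XY Ys; rewrite mem_set.
Qed.

Definition zeros l x := forall i, (x i 0 == 0) = (i < l)%N.

Lemma card_std_loops l : (l <= n)%N -> #|std_loops n l| = l.
Proof.
move=> ln; rewrite -sum1dep_card (big_ord_narrow ln).
by rewrite sum_nat_const card_ord muln1.
Qed.

Lemma card_std_class l p : (l + p <= n)%N -> #|std_class n l p| = p.
Proof.
move=> lpn; have -> : std_class n l p = std_loops n (l + p) :\: std_loops n l.
  by apply/setP => i; rewrite !inE -leqNgt.
rewrite cardsD (setIidPr _) ?card_std_loops ?addKn//; first by lia.
by apply/subsetP => i; rewrite !inE => il; rewrite ltn_addr.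
Qed.

(** The permutation maps the [l'] loops into the [l] zeros of [x]; when the numbers agree, it maps
    them onto the zeros. *)
Lemma pair_polytope_zeros l l' P x (s : 'S_n) : (l <= n)%N -> (l' <= n)%N ->
  zeros l x -> pair_polytope (std_loops n l') P (row_perm s x) ->
  (l' <= l)%N /\ (l' = l -> forall i, ((s i < l) = (i < l))%N).
Proof.
move=> ln ln' xl [_ _ xN _].
have sub : s @: std_loops n l' \subset std_loops n l.
  apply/subsetP => _ /imsetP[i iL ->]; rewrite inE -xl.
  by have := xN _ iL; rewrite mxE => ->.
have cs : #|s @: std_loops n l'| = l'.
  by rewrite card_imset ?card_std_loops//; exact: perm_inj.
split; first by rewrite -cs -(card_std_loops ln) subset_leq_card.
move=> ll i; have /eqP sE : s @: std_loops n l' == std_loops n l.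
  by rewrite eqEcard sub cs card_std_loops ?ll/=.
move: (mem_imset (std_loops n l') i (@perm_inj _ s)).
by rewrite sE !inE ll.
Qed.

Lemma zeros_row_perm l x (s : 'S_n) : zeros l x ->
  (forall i, ((s i < l) = (i < l))%N) -> zeros l (row_perm s x).
Proof. by move=> xl sl i; rewrite mxE xl. Qed.

Lemma schubert_indic_zeros l l' p x : (l <= n)%N -> (l' <= n)%N -> zeros l x ->
  (l < l')%N -> schubert_indic l' p x = 0.
Proof.
move=> ln ln' xl ll; rewrite /schubert_indic /sym_indic big1 ?mulr0// => s _.
rewrite indicE memNset// => /(pair_polytope_zeros ln ln' xl)[].
by rewrite leqNgt ll.
Qed.

Section WeightedPoint.
Variables (l N : nat) (w : 'I_n -> nat).
Hypotheses (ln : (l <= n)%N) (N0 : (0 < N)%N) (wN : forall i, (w i <= N)%N).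
Hypotheses (w2 : (\sum_i w i = N.*2)%N) (w0 : forall i, (0 < w i)%N = (l <= i)%N).

(** Integer weights over a common denominator turn membership in the polytopes into inequalities
    between natural numbers. *)
Definition wpoint : 'cV[R]_n := \col_i ((w i)%:R / N%:R).

Let N0R : (0 < N%:R :> R). Proof. by rewrite ltr0n. Qed.

Lemma zeros_wpoint : zeros l wpoint.
Proof.
move=> i; rewrite mxE mulf_eq0 invr_eq0 (gt_eqF N0R) orbF pnatr_eq0.
by rewrite -leqn0 leqNgt w0 -ltnNge.
Qed.

Lemma pair_polytope_wpoint P (s : 'S_n) :
  pair_polytope (std_loops n l) P (row_perm s wpoint) <->
  (forall i : 'I_n, ((s i < l) = (i < l))%N) /\
  (\sum_(i in P) w (s i) <= N)%N.
Proof.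
have sum_wpoint (Q : pred 'I_n) : \sum_(i | Q i) row_perm s wpoint i 0 =
    (\sum_(i | Q i) w (s i))%N%:R / N%:R.
  by rewrite natr_sum mulr_suml; apply: eq_bigr => i _; rewrite !mxE.
rewrite -(ler_nat R) -[in leRHS](mul1r N%:R).
rewrite -ler_pdivrMr// -(sum_wpoint (mem P)); split.
  move=> h; split; last by case: h.
  by case: (pair_polytope_zeros ln ln zeros_wpoint h) => _; apply.
move=> [sl sP]; split=> //.
- move=> i; rewrite !mxE divr_ge0 ?ler0n//= ler_pdivrMr// mul1r ler_nat.
  exact: wN.
- rewrite (sum_wpoint xpredT).
  have -> : (\sum_i w (s i) = \sum_(i < n) w i)%N.
    by rewrite [RHS](reindex_inj (@perm_inj _ s)).
  by rewrite w2 -muln2 natrM mulrAC divff ?mul1r// gt_eqF.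
- move=> i; rewrite inE => il; apply/eqP.
  by rewrite (zeros_row_perm zeros_wpoint sl).
Qed.

End WeightedPoint.

Section Points.
Variables (l p q : nat).
Hypotheses (p0 : (0 < p)%N) (q0 : (0 < q)%N) (lpq : (l + p + q = n)%N).

(** The elements of the parallel class, as well as the remaining elements, have
    weight [p * q] in total. *)
Definition weight (i : nat) : nat :=
  if (i < l)%N then 0%N else if i == l then (p * q.-1).+1
  else if (i < l + p)%N then 1%N else p.

Lemma weight_gt0 i : (0 < weight i)%N = (l <= i)%N.
Proof.
rewrite /weight; case: (ltnP i l) => // _; case: (i == l) => //.
by case: (ltnP i (l + p)).
Qed.

Lemma weight_le i : (weight i <= p * q)%N.
Proof.
rewrite /weight; case: (ltnP i l) => // _; case: (i == l).
  by case: q q0 => // q' _; rewrite mulnS; lia.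
by case: ifP => _; rewrite ?leq_pmulr// muln_gt0 p0.
Qed.

Lemma sum_weight_class : (\sum_(l <= i < l + p) weight i = p * q)%N.
Proof.
rewrite big_ltn; last by lia.
rewrite {1}/weight ltnn eqxx (eq_big_nat _ _ (F2 := fun=> 1%N)).
  by rewrite sum_nat_const_nat; case: q q0 => // q' _; rewrite mulnS; lia.
by move=> i /andP[li ip]; rewrite /weight ip ltnNge (ltnW li) gtn_eqF.
Qed.

Lemma sum_weight : (\sum_(i < n) weight i = p * q + p * q)%N.
Proof.
rewrite -(big_mkord xpredT weight) (@big_cat_nat _ _ _ l)//=; last by lia.
rewrite [X in (_ + X)%N](@big_cat_nat _ _ _ (l + p))/=; [|lia|lia].
rewrite sum_weight_class [X in (X + _)%N]big_nat big1 ?add0n; last first.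
  by move=> i /andP[_ il]; rewrite /weight il.
rewrite (eq_big_nat _ _ (F2 := fun=> p)); last first.
  move=> i /andP[li ip]; rewrite /weight; case: (ltnP i l); [lia|].
  case: (eqVneq i l); [lia|].
  by case: (ltnP i (l + p)); lia.
by rewrite sum_nat_const_nat; congr addn; rewrite -lpq addKn mulnC.
Qed.

Definition point := wpoint (p * q) weight.

Let pq0 : (0 < p * q)%N. Proof. by rewrite muln_gt0 p0. Qed.
Let ln : (l <= n)%N. Proof. by lia. Qed.

Lemma zeros_point : zeros l point.
Proof. by apply: zeros_wpoint => // i; exact: weight_gt0. Qed.

Lemma pair_polytope_point P (s : 'S_n) :
  pair_polytope (std_loops n l) P (row_perm s point) <->
  (forall i : 'I_n, ((s i < l) = (i < l))%N) /\
  (\sum_(i in P) weight (s i) <= p * q)%N.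
Proof.
apply: pair_polytope_wpoint => // [i||i]; first exact: weight_le.
  by rewrite sum_weight addnn.
exact: weight_gt0.
Qed.

Lemma sum_weight_std_class : (\sum_(i in std_class n l p) weight i = p * q)%N.
Proof.
rewrite (eq_bigl (fun i : 'I_n => l <= i < l + p)%N) => [|i]; last by rewrite inE.
rewrite -(big_mkord (fun i => l <= i < l + p)%N weight).
rewrite -sum_weight_class (@big_nat_widenl _ _ _ l 0)//.
rewrite (@big_nat_widen _ _ _ 0 (l + p) n)/=; last by lia.
by apply: eq_bigl.
Qed.

Lemma pair_polytope_point1 : pair_polytope (std_loops n l) (std_class n l p) point.
Proof.
rewrite -[point](row_perm1); apply/pair_polytope_point; split=> [i|].
  by rewrite perm1.
by under eq_bigr do rewrite perm1; rewrite sum_weight_std_class.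
Qed.

Section Shifted.
Hypothesis p1 : (1 < p)%N.
Variables (i0 i1 : 'I_n).
Hypotheses (i0E : i0 = l :> nat) (i1E : i1 = n.-1 :> nat).

(** A small amount is moved from the last element to the parallel class. *)
Definition shifted_weight (i : 'I_n) : nat :=
  ((weight i).*2 + (i == i0) - (i == i1))%N.

(** As the weights are doubled, half a unit of the old weight is moved, so only constraints that are
    tight at [point] can become violated. *)
Definition shifted_point := wpoint (p * q).*2 shifted_weight.

Let i01 : i0 != i1.
Proof. by rewrite -(inj_eq val_inj) /= i0E i1E; lia. Qed.

Let weight_i0 : weight i0 = (p * q.-1).+1.
Proof. by rewrite /weight i0E ltnn eqxx. Qed.

Let weight_i1 : weight i1 = p.
Proof.
rewrite /weight i1E; case: ltnP; [lia|]; case: eqP; [lia|].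
by case: ltnP; lia.
Qed.

Lemma shifted_weight_gt0 i : (0 < shifted_weight i)%N = (l <= i)%N.
Proof.
rewrite /shifted_weight -weight_gt0; case: (eqVneq i i1) => [->|_].
  by rewrite weight_i1 eq_sym (negbTE i01); lia.
rewrite /= subn0 addn_gt0 double_gt0.
by case: (eqVneq i i0) => [->|_]; rewrite ?weight_i0 ?orbF.
Qed.

Lemma shifted_weight_le i : (shifted_weight i <= (p * q).*2)%N.
Proof.
rewrite /shifted_weight; have := weight_le i; case: (eqVneq i i0) => [->|_].
  rewrite weight_i0 (negbTE i01); case: q q0 => // q' _; rewrite mulnS /=.
  lia.
by lia.
Qed.

(** The subtracted term stands on the left, to avoid truncated subtraction. *)
Lemma sum_shifted_weight (P : {set 'I_n}) (s : 'S_n) :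
  (\sum_(i in P) shifted_weight (s i) + (s^-1 i1 \in P)%g =
   (\sum_(i in P) weight (s i)).*2 + (s^-1 i0 \in P)%g)%N.
Proof.
have sumE j : (\sum_(i in P) (s i == j) = (s^-1 j \in P)%g)%N.
  case: (boolP (s^-1%g j \in P)) => [jP|jP].
    rewrite (bigD1 (s^-1%g j))//= permKV eqxx big1// => i /andP[_ ij].
    by case: eqP => // sij; rewrite -sij permK eqxx in ij.
  rewrite big1// => i iP; case: eqP => // sij.
  by rewrite -sij permK iP in jP.
rewrite -!sumE -big_split/= -mul2n big_distrr /= -big_split /=.
apply: eq_bigr => i _; rewrite /shifted_weight mul2n subnK//.
case: (eqVneq (s i) i1) => [->|_] //.
by rewrite weight_i1; lia.
Qed.

Lemma total_shifted_weight : (\sum_i shifted_weight i = (p * q).*2.*2)%N.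
Proof.
have := sum_shifted_weight setT 1%g; rewrite !inE => /eqP.
rewrite eqn_add2r => /eqP; under eq_bigl do rewrite inE.
under eq_bigr do rewrite perm1.
move=> ->; under eq_bigl do rewrite inE.
under eq_bigr do rewrite perm1.
by rewrite sum_weight addnn.
Qed.

Lemma zeros_shifted_point : zeros l shifted_point.
Proof.
by apply: zeros_wpoint => [|i]; rewrite ?double_gt0// shifted_weight_gt0.
Qed.

Lemma pair_polytope_shifted_point P (s : 'S_n) :
  pair_polytope (std_loops n l) P (row_perm s shifted_point) <->
  (forall i : 'I_n, ((s i < l) = (i < l))%N) /\
  ((\sum_(i in P) weight (s i)).*2 + (s^-1 i0 \in P)%g <=
   (p * q).*2 + (s^-1 i1 \in P)%g)%N.
Proof.
rewrite -sum_shifted_weight leq_add2r.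
apply: pair_polytope_wpoint; rewrite ?double_gt0 ?total_shifted_weight//.
  exact: shifted_weight_le.
exact: shifted_weight_gt0.
Qed.

(** A violation at [point] is at least 2 in doubled weights, and the move recovers at most 1. *)
Lemma pair_polytope_shifted_sub P (s : 'S_n) :
  pair_polytope (std_loops n l) P (row_perm s shifted_point) ->
  pair_polytope (std_loops n l) P (row_perm s point).
Proof.
move=> /pair_polytope_shifted_point[sl sP]; apply/pair_polytope_point; split=> //; lia.
Qed.

(** A newly violated class is tight at [point] and contains the heavy element, of weight
    [p * q.-1 + 1]. Its other elements share the weight [p - 1], so none of them has weight [p];
    they are [p - 1] elements of weight 1, and the class has size [p]. *)
Lemma pair_polytope_shifted_eq p' (s : 'S_n) : (l + p' <= n)%N -> p' != p ->
  pair_polytope (std_loops n l) (std_class n l p') (row_perm s point) ->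
  pair_polytope (std_loops n l) (std_class n l p') (row_perm s shifted_point).
Proof.
move=> lpn pp /pair_polytope_point[sl sP]; apply/pair_polytope_shifted_point; split=> //.
set P := std_class n l p' in sP *; set V := (\sum_(i in P) _)%N in sP *.
have [|j0P] := boolP (s^-1%g i0 \in P); last by lia.
move=> j0P; rewrite leqNgt; apply/negP => lt.
have VE : V = (p * q)%N by lia.
have e : (\sum_(i in P :\ (s^-1)%g i0) weight (s i) = p.-1)%N.
  move: VE; rewrite /V (big_setD1 _ j0P)/= permKV weight_i0.
  by case: q q0 => // q' _; rewrite mulnS; lia.
have iP i : i \in P :\ (s^-1)%g i0 -> (l <= s i)%N /\ (s i == l :> nat) = false.
  rewrite !inE => /andP[ij0 /andP[li _]]; split; first by rewrite leqNgt sl -leqNgt.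
  rewrite -i0E; apply/negbTE; apply: contra ij0 => /eqP/val_inj <-.
  by rewrite permK.
have wP i : i \in P :\ (s^-1)%g i0 -> weight (s i) = 1%N.
  move=> ip; have [li sil] := iP _ ip.
  rewrite /weight ltnNge li sil /=; case: ltnP => // lpi.
  move: e; rewrite (big_setD1 _ ip)/= {1}/weight ltnNge li sil /= ltnNge lpi /=.
  by lia.
move: e; rewrite (eq_bigr _ wP) sum1_card => cP.
have := cardsD1 ((s^-1)%g i0) P; rewrite j0P cP card_std_class// => pE.
by case/eqP: pp; lia.
Qed.

(** The class is tight at [point], contains [i0] and misses [i1]. *)
Lemma not_pair_polytope_shifted :
  ~ pair_polytope (std_loops n l) (std_class n l p) shifted_point.
Proof.
rewrite -[shifted_point]row_perm1 => /pair_polytope_shifted_point[_].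
under eq_bigr do rewrite perm1.
rewrite sum_weight_std_class invg1 !perm1 !inE i0E i1E; lia.
Qed.

End Shifted.
End Points.

(** By induction on [l]: at a point with exactly [l] zeros the matroids with
    more than [l] loops do not contribute, and the difference of the values at
    [point] and [shifted_point] only sees the class size [p]. *)
Lemma schubert_indic_free (d : nat -> nat -> R) :
  (forall x, \sum_(l < n) \sum_(1 <= p < n - l) d l p * schubert_indic l p x = 0) ->
  forall l p, (0 < p)%N -> (l + p < n)%N -> d l p = 0.
Proof.
move=> d0; elim/ltn_ind => l IH p p0 lpn.
have ln : (l < n)%N by lia.
have block x : zeros l x ->
    \sum_(1 <= p < n - l) d l p * schubert_indic l p x = 0.
  move=> xl; rewrite -[RHS](d0 x) (bigD1 (Ordinal ln))//= [X in _ + X]big1 ?addr0//.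
  move=> k kl; rewrite big_nat big1// => r /andP[r0 rk].
  have [kl'|lk] := ltnP k l; first by rewrite IH ?mul0r//; lia.
  rewrite (@schubert_indic_zeros l) ?mulr0//; [lia|lia|].
  by rewrite ltn_neqAle lk andbT eq_sym.
have large r : (1 < r)%N -> (l + r < n)%N -> d l r = 0.
  move=> r1 lrn; have r0 : (0 < r)%N by lia.
  have q0 : (0 < n - l - r)%N by lia.
  have lrq : (l + r + (n - l - r) = n)%N by lia.
  have n1 : (n.-1 < n)%N by lia.
  pose x0 := point l r (n - l - r).
  pose x1 := shifted_point l r (n - l - r) (Ordinal ln) (Ordinal n1).
  have /eqP : \sum_(1 <= p < n - l)
      d l p * (schubert_indic l p x0 - schubert_indic l p x1) = 0.
    under eq_bigr do rewrite mulrBr.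
    rewrite sumrB !block ?subrr//; first exact: zeros_shifted_point.
    exact: zeros_point.
  rewrite (bigD1_seq r) ?iota_uniq ?mem_index_iota//=; last by lia.
  rewrite [X in _ + X]big1_seq ?addr0 => [|k].
    rewrite mulf_eq0 subr_eq0 => /orP[/eqP//|/eqP rE].
    have : schubert_indic l r x1 < schubert_indic l r x0.
      apply: sym_indic_lt.
      - by move=> s; apply: pair_polytope_shifted_sub.
      - exact: not_pair_polytope_shifted.
      - exact: pair_polytope_point1.
    by rewrite rE ltxx.
  rewrite mem_index_iota => /andP[kr /andP[k0 kn]].
  apply/eqP; rewrite mulf_eq0 subr_eq0; apply/orP; right; rewrite eq_le.
  apply/andP; split; apply: sym_indic_le => s.
    by apply: pair_polytope_shifted_eq => //; lia.
  exact: pair_polytope_shifted_sub.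
(* For size 1 the element [l] of [point] already has coordinate 1, so no weight can be moved to it.
   But the larger sizes are settled, and the one remaining term has a positive factor at [point]. *)
case: (ltnP 1 p) => [p1|p1]; first exact: large.
have -> : p = 1%N by lia.
have q0 : (0 < n - l - 1)%N by lia.
have l1q : (l + 1 + (n - l - 1) = n)%N by lia.
have /eqP := block _ (@zeros_point l 1 (n - l - 1) isT q0).
rewrite big_ltn; last by lia.
rewrite big_nat big1 ?addr0 => [|r /andP[r1 rn]]; last by rewrite large ?mul0r//; lia.
rewrite mulf_eq0 => /orP[/eqP//|/eqP fE].
have : 0 < schubert_indic l 1 (point l 1 (n - l - 1)).
  have : sym_indic classical_sets.set0 (point l 1 (n - l - 1)) <
      schubert_indic l 1 (point l 1 (n - l - 1)).
    by apply: sym_indic_lt => //; exact: pair_polytope_point1.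
  by rewrite {1}/sym_indic big1 ?mulr0// => s _; rewrite indic0.
by rewrite fE ltxx.
Qed.

End Independence.

(** * The order of the Schubert matroids *)

Section Order.

(** The recursion is started at 0 instead of 3, so that inductions need no special cases. *)
Fixpoint rank2_order (n : nat) : seq (nat * nat) :=
  if n is m.+1 then
    [seq (x.1.+1, x.2.+1) | x <- rank2_order m] ++ [seq (1%N, b) | b <- rev (iota 2 m)]
  else [::].

(** [schubert2_order n] is empty for [n < 3], unlike [rank2_order 2]. *)
Lemma rank2_orderE n : (3 <= n)%N -> schubert2_order n = rank2_order n.
Proof.
case: n => [|[|[|n]]] // _; elim: n => [//|n IH].
have -> : schubert2_order n.+4 = [seq (x.1.+1, x.2.+1) | x <- schubert2_order n.+3]
   ++ [seq (1%N, b) | b <- rev (iota 2 n.+3)] by [].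
by rewrite IH.
Qed.

Lemma size_rank2_order n : size (rank2_order n) = O2_nrows n.
Proof. by elim: n => //= n IH; rewrite size_cat !size_map IH size_rev size_iota. Qed.

Lemma mem_rank2_order n s : s \in rank2_order n ->
  exists l p, [/\ (0 < p)%N, (l + p < n)%N & s = (l.+1, (l + p).+1)].
Proof.
elim: n s => //= n IH s; rewrite mem_cat => /orP[] /mapP[x].
  by move=> /IH[l [p [p0 lpn ->]]] ->; exists l.+1, p; rewrite addSn.
rewrite mem_rev mem_iota => /andP[x1 xn] ->; exists 0%N, x.-1.
by rewrite add0n; split; [lia|lia|rewrite prednK//; lia].
Qed.

Lemma uniq_rank2_order n : uniq (rank2_order n).
Proof.
elim: n => //= n IH; rewrite cat_uniq !map_inj_uniq; first last.
- by move=> [a b] [c d] [-> ->].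
- by move=> a b [].
rewrite IH rev_uniq iota_uniq andbT /=; apply/hasPn => _ /mapP[b _ ->].
by apply/negP => /mapP[x /mem_rank2_order[l [p [_ _ ->]]]].
Qed.

Lemma big_rank2_order (R : nmodType) n (F : nat * nat -> R) :
  \sum_(s <- rank2_order n) F s =
  \sum_(l < n) \sum_(1 <= p < n - l) F (l.+1, (l + p).+1).
Proof.
elim: n F => [|n IH] F; first by rewrite big_nil big_ord0.
rewrite /= big_cat !big_map /= IH big_ord_recl /= addrC; congr (_ + _).
rewrite big_rev /= subn0 -[iota 2 n]/(iota (1 + 1) n) iotaDl big_map.
rewrite /index_iota subSS subn0 /=; apply: eq_bigr => p _.
by rewrite add0n.
Qed.

End Order.

(** * The columns of the blocks [U(n)] and [V(n)] *)

Section Columns.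
Variable R : realType.

Definition is_col m k (A : 'M[R]_(m, k)) (v : 'cV[R]_m) := exists j, v = col j A.

Lemma is_col_row_mx m k1 k2 (A : 'M_(m, k1)) (B : 'M_(m, k2)) v :
  is_col (row_mx A B) v <-> is_col A v \/ is_col B v.
Proof.
split=> [[j ->]|[[j ->]|[j ->]]].
- case: (split_ordP j) => j' ->; [left|right]; exists j'; first exact: colKl.
  exact: colKr.
- by exists (lshift _ j); rewrite colKl.
- by exists (rshift _ j); rewrite colKr.
Qed.

Lemma is_col_col_mx0 m1 m2 k (A : 'M_(m1, k)) (v : 'cV_(m1 + m2)) :
  is_col (col_mx A 0) v <-> exists2 w, is_col A w & v = col_mx w 0.
Proof.
have colE j : col j (col_mx A (0 : 'M_(m2, k))) = col_mx (col j A) 0.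
  by rewrite col_col_mx col0.
split=> [[j ->]|[_ [j ->] ->]]; last by exists j; rewrite colE.
by exists (col j A); [exists j | rewrite colE].
Qed.

Lemma is_col_col_mx0l m1 m2 k (A : 'M_(m2, k)) (v : 'cV_(m1 + m2)) :
  is_col (col_mx 0 A) v <-> exists2 w, is_col A w & v = col_mx 0 w.
Proof.
have colE j : col j (col_mx (0 : 'M_(m1, k)) A) = col_mx 0 (col j A).
  by rewrite col_col_mx col0.
split=> [[j ->]|[_ [j ->] ->]]; last by exists j; rewrite colE.
by exists (col j A); [exists j | rewrite colE].
Qed.

(** Row [i] is the coefficient of [S(1, n - i)], for the class size [n - 1 - i]. *)
Definition coef_block (n : nat) (u : nat -> nat) : 'cV[R]_(n.-1) :=
  \col_i coef R n u (n.-1 - i).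

(** The number of elements in the classes of sizes 2 to [n - 1], given [u p] classes of size [p]. *)
Definition part_sum (n : nat) (u : nat -> nat) : nat := (\sum_(2 <= p < n) p * u p)%N.

Lemma eq_coef_block n u u' : (forall p, (1 < p < n)%N -> u p = u' p) ->
  coef_block n u = coef_block n u'.
Proof.
move=> uu; apply/matrixP => i j; rewrite !mxE /coef.
have -> : (\sum_(2 <= q < n) u q = \sum_(2 <= q < n) u' q)%N by apply: eq_big_nat.
case: eqP => // p1; rewrite uu//.
by have := ltn_ord i; lia.
Qed.

(** One more nonloop adds a row for the new largest size; this is the zero row on top of
    [V(n - 1)]. *)
Lemma coef_blockS k u : (0 < k)%N -> u k.+1 = 0%N ->
  coef_block k.+2 u = col_mx (0 : 'cV_1) (coef_block k.+1 u).
Proof.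
move=> k0 uk; apply/matrixP => i j; rewrite !mxE /=; case: splitP => i' ii'.
  rewrite (ord1 i') in ii'; rewrite mxE ii' subn0 /coef ifF ?uk//.
  by apply/eqP; lia.
by rewrite mxE ii' subSS /coef big_nat_recr//= uk addn0.
Qed.

Lemma sum_rev_ord (N : nat) (F : nat -> nat) :
  (\sum_(2 <= p < N) F p = \sum_(i < N.-2) F (N.-1 - i))%N.
Proof.
rewrite big_nat_rev /= (big_addn 0 _ 2) subn2 big_mkord; apply: eq_bigr => i _.
by congr F; have := ltn_ord i; lia.
Qed.

(** The rows of [U(n)] count the classes by decreasing size, and the row below them is the
    coefficient at size 1. *)
Lemma is_col_U k v :
  is_col (add_last_row (U_mx R k.+4.+1) (const_mx 1 - const_mx 1 *m U_mx R k.+4.+1)) v <->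
  exists2 u, part_sum k.+4.+1 u = k.+4.+1 & v = coef_block k.+4.+1 u.
Proof.
have colE j (u : nat -> nat) :
    (forall i, U_mx R k.+4.+1 i j = (u (k.+4 - i)%N)%:R) ->
    col j (add_last_row (U_mx R k.+4.+1) (const_mx 1 - const_mx 1 *m U_mx R k.+4.+1)) =
    coef_block k.+4.+1 u.
  move=> Uu; apply/matrixP => i i'.
  rewrite [LHS]mxE castmxE mxE; case: splitP => i2 /= ii.
    rewrite cast_ord_id Uu mxE ii /coef ifF//.
    by apply/negbTE; have /= := ltn_ord i2; rewrite eqn_leq; lia.
  rewrite cast_ord_id !mxE /coef ifT; last first.
    by move: ii; rewrite (ord1 i2) /= addn0 => ->; rewrite subSnn.
  rewrite sum_rev_ord natr_sum; congr (_ - _).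
  by apply: eq_bigr => l _; rewrite [const_mx _ _ _]mxE mul1r Uu.
split=> [[j ->]|[u us ->]].
  pose f := enum_val j; pose u p := nat_of_ord (f (inord (k.+4 - p))).
  have uE (i : 'I_k.+3) : u (k.+4 - i)%N = f i.
    rewrite /u; congr (nat_of_ord (f _)); apply/val_inj.
    by rewrite /= inordK; have := ltn_ord i; lia.
  exists u.
    have := enum_valP j; rewrite inE => /eqP fs.
    rewrite /part_sum sum_rev_ord -[RHS]fs; apply: eq_bigr => i _.
    by rewrite uE.
  by apply: colE => i; rewrite mxE uE.
(* No entry is truncated by [inord], thanks to [U_sol_bound]. *)
pose f := [ffun i : 'I_k.+4.+1.-2 => inord (u (k.+4 - i)%N) : 'I_k.+4.+2].
have fE i : f i = u (k.+4 - i)%N :> nat.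
  rewrite ffunE inordK// ltnS.
  have := us; rewrite /part_sum sum_rev_ord.
  by move=> /(@U_sol_bound k.+4.+1 (fun i => u (k.+4 - i)%N)); apply.
have fU : f \in U_sol k.+4.+1.
  rewrite inE; apply/eqP; rewrite -[RHS]us /part_sum sum_rev_ord.
  by apply: eq_bigr => i _; rewrite fE.
exists (enum_rank_in fU f); rewrite (colE _ u)// => i.
by rewrite mxE /= enum_rankK_in// fE.
Qed.

Lemma big_nat24 (F : nat -> nat) : (\sum_(2 <= p < 4) F p = F 2 + F 3)%N.
Proof. by rewrite big_ltn// big_ltn// big_geq// addn0. Qed.

(** The block added at stage [m] lists the class sizes that use up exactly [m] elements; later
    stages only pad it with zero rows. *)
Lemma is_col_V k v : is_col (V_mx R k.+4) v <->
  exists u m, [/\ (4 <= m <= k.+4)%N, part_sum m u = m,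
    forall p, (m <= p < k.+4)%N -> u p = 0%N & v = coef_block k.+4 u].
Proof.
elim: k v => [|k IH] v.
  (* The only solution of [2 * u 2 + 3 * u 3 = 4] is [u 2 = 2], [u 3 = 0]. *)
  have wE u : part_sum 4 u = 4%N -> coef_block 4 u = \col_(i < 3) [:: 0; 2; -1]`_i.
    rewrite /part_sum big_nat24 => us.
    have [u2 u3] : u 2%N = 2%N /\ u 3%N = 0%N by lia.
    apply/matrixP => i j; rewrite !mxE /coef big_nat24 u2 u3 addn0.
    by case: i => [[|[|[|]]]]//= _; rewrite ?subn0 ?u2 ?u3 ?subSnn//=; lra.
  split=> [[j ->]|[u [m [m4 us _ ->]]]].
    exists (fun p => if p == 2%N then 2%N else 0%N), 4%N.
    rewrite wE; last by rewrite /part_sum big_nat24.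
    split=> //; first by rewrite /part_sum big_nat24.
      by move=> p; lia.
    by apply/matrixP => i j'; rewrite !mxE.
  exists ord0; have m4' : m = 4%N by lia.
  rewrite wE -?m4'//; by apply/matrixP => i j'; rewrite !mxE.
have -> : V_mx R k.+4.+1 = row_mx (col_mx (0 : 'rV_(V_ncols k.+4)) (V_mx R k.+4))
    (add_last_row (U_mx R k.+4.+1) (const_mx 1 - const_mx 1 *m U_mx R k.+4.+1)) by [].
have colV := @is_col_col_mx0l 1 _ _ (V_mx R k.+4).
split.
  move=> /is_col_row_mx[/colV[w /IH[u [m [m4 us u0 ->]]] ->]|].
    (* The value at the new size [k.+4] is not controlled by the induction hypothesis and must be 0
       for the zero row. *)
    pose u' p := if p == k.+4 then 0%N else u p.
    exists u', m; split.
    - lia.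
    - rewrite -[RHS]us; apply: eq_big_nat => p pm; rewrite /u' ifF//.
      by apply/eqP; lia.
    - by move=> p pm; rewrite /u'; case: eqP => // pk; apply: u0; lia.
    rewrite (@coef_blockS k.+3 u')//; last by rewrite /u' eqxx.
    apply: (congr1 (col_mx (0 : 'cV_1))); apply: (@eq_coef_block k.+4) => p pk.
    rewrite /u' ifF//.
    by apply/eqP; lia.
  by move=> /is_col_U[u us ->]; exists u, k.+4.+1; split=> // [|p]; lia.
move=> [u [m [m4 us u0 ->]]]; apply/is_col_row_mx.
have [mk|mk] := eqVneq m k.+4.+1.
  by right; apply/is_col_U; exists u; rewrite -?mk.
left; apply/colV; exists (coef_block k.+4 u).
  by apply/IH; exists u, m; split=> //; [lia|move=> p pk; apply: u0; lia].
by rewrite (@coef_blockS k.+3)//; apply: u0; lia.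
Qed.

Definition one_part (a p : nat) : nat := p == a.

Lemma sum_one_part (a N : nat) (F : nat -> nat) :
  (\sum_(2 <= p < N) F p * one_part a p = if 2 <= a < N then F a else 0)%N.
Proof.
rewrite -(@big_nat1_eq nat 0%N addn) [RHS]big_mkcond; apply: eq_bigr => p _.
by rewrite /one_part; case: eqP => _; rewrite ?muln1 ?muln0.
Qed.

(** A single class of size at least 2 makes the coefficient at size 1 equal to [1 - 1 = 0]; without
    such a class it is 1. *)
Lemma col_id_coef_block (N : nat) (j : 'I_N.-1) :
  col j (1%:M : 'M[R]_(N.-1)) = coef_block N (one_part (N.-1 - j)).
Proof.
apply/matrixP => i i'; rewrite !mxE /coef.
have -> : (\sum_(2 <= q < N) one_part (N.-1 - j) q)%N = (N.-1 - j != 1)%N.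
  under eq_bigr do rewrite -[one_part _ _]mul1n.
  rewrite (sum_one_part _ _ (fun=> 1%N)); have := ltn_ord j.
  by case: ifP; case: eqP; lia.
have -> : (i == j) = (N.-1 - i == N.-1 - j)%N.
  by rewrite -val_eqE /=; have := ltn_ord j; have := ltn_ord i; lia.
rewrite /one_part; case: (eqVneq (N.-1 - i)%N 1%N) => [->|//].
by rewrite eq_sym; case: eqP; rewrite ?subr0 ?subrr.
Qed.

(** Every counted class of a size other than [p] has at least two elements. *)
Lemma part_sum_ge (N p : nat) u : (1 < p < N)%N ->
  (p * u p + ((\sum_(2 <= q < N) u q) - u p).*2 <= part_sum N u)%N.
Proof.
move=> pN; have pr : p \in index_iota 2 N by rewrite mem_index_iota.
rewrite /part_sum [leqRHS](bigD1_seq p)//= ?iota_uniq// leq_add2l.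
rewrite (bigD1_seq p)//= ?iota_uniq// addKn -mul2n big_distrr /=.
rewrite big_seq_cond [leqRHS]big_seq_cond; apply: leq_sum => q.
by rewrite mem_index_iota => /andP[/andP[q2 _] _]; rewrite leq_mul2r q2 orbT.
Qed.

(** At most one class of size at least 2 gives a unit vector. Otherwise the classes use up some
    [m >= 4] elements and each has size at most [m - 2], so that [u] belongs to the block of [V]
    added at stage [m]. *)
Lemma is_col_id_V k v : is_col (row_mx (1%:M : 'M_(k.+4.-1)) (V_mx R k.+4)) v <->
  exists2 u, (part_sum k.+4 u <= k.+4)%N & v = coef_block k.+4 u.
Proof.
split.
  move=> /is_col_row_mx[[j ->]|/is_col_V[u [m [m4 us u0 ->]]]].
    exists (one_part (k.+4.-1 - j)); last exact: col_id_coef_block.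
    by rewrite /part_sum sum_one_part; case: ifP => //; lia.
  exists u => //; rewrite /part_sum (@big_cat_nat _ _ _ m)//=; [|lia|lia].
  rewrite [X in (_ + X)%N]big_nat [X in (_ + X)%N]big1 => [|p pm]; last by rewrite u0 ?muln0.
  by rewrite addn0 -/(part_sum m u) us; lia.
move=> [u us ->]; apply/is_col_row_mx.
pose S := (\sum_(2 <= q < k.+4) u q)%N.
have unit_case a : (0 < a < k.+4)%N ->
    (forall p, (1 < p < k.+4)%N -> u p = one_part a p) ->
    is_col (1%:M : 'M_(k.+4.-1)) (coef_block k.+4 u).
  move=> ak ua; have aN : (k.+3 - a < k.+4.-1)%N by lia.
  exists (Ordinal aN); rewrite col_id_coef_block; apply: eq_coef_block => p pk.
  by rewrite ua//=; congr one_part; lia.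
have [/existsP[[a ak] /andP[a1 ua]]|nua] :=
  boolP [exists a : 'I_k.+4, (1 < a)%N && (0 < u a)%N]; last first.
  left; apply: (unit_case 1%N) => // p /andP[p1 pk].
  have : ~~ (0 < u p)%N.
    by apply: contra nua => up; apply/existsP; exists (Ordinal pk); rewrite /= p1.
  by rewrite /one_part; case: eqP; lia.
rewrite /= in a1 ua.
have [S1|S1] := leqP S 1.
  left; apply: (unit_case a); first by lia.
  move=> p pk; have pr : p \in index_iota 2 k.+4 by rewrite mem_index_iota.
  have ar : a \in index_iota 2 k.+4 by rewrite mem_index_iota a1.
  move: S1; rewrite /S /one_part (bigD1_seq a ar (iota_uniq _ _)).
  case: (eqVneq p a) => [->|pa] /=; first by lia.
  by rewrite (big_rem _ pr) /= pa; lia.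
right; apply/is_col_V; exists u, (part_sum k.+4 u).
have small p : (1 < p < k.+4)%N -> (0 < u p)%N -> (p.+2 <= part_sum k.+4 u)%N.
  move=> pk up; have := part_sum_ge u pk; rewrite -/S; nia.
have a2 : (a.+2 <= part_sum k.+4 u)%N by apply: small; rewrite ?a1.
have u0 p : (part_sum k.+4 u <= p < k.+4)%N -> u p = 0%N.
  move=> pm; apply/eqP; rewrite -leqn0 leqNgt; apply/negP => up.
  have : (p.+2 <= part_sum k.+4 u)%N by apply: small => //; lia.
  by lia.
split=> //; first by lia.
rewrite [RHS]/part_sum [RHS](@big_cat_nat _ _ _ (part_sum k.+4 u))//=; last by lia.
rewrite [X in (_ + X)%N]big_nat [X in (_ + X)%N]big1 ?addn0// => p pm.
by rewrite u0 ?muln0.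
Qed.

End Columns.

(** * The columns of the whole matrix *)

Section O2.
Variable R : realType.

Definition order_vec (n : nat) (g : nat * nat -> R) : 'cV[R]_(O2_nrows n) :=
  \col_i g (nth (0, 0)%N (rank2_order n) i).

(** The matroid [S(x1, x2)] has [x1 - 1] loops and a class of size [x2 - x1]. *)
Definition loop_coefs (n l : nat) (u : nat -> nat) (s : nat * nat) : R :=
  if s.1 == l.+1 then coef R (n - l) u (s.2 - s.1) else 0.

Lemma order_vecS m g : order_vec m.+1 g =
  col_mx (order_vec m (fun x => g (x.1.+1, x.2.+1))) (\col_(i < m) g (1, m.+1 - i)%N).
Proof.
apply/matrixP => i j; rewrite !mxE /= nth_cat size_map size_rank2_order.
case: splitP => i' ii'; rewrite mxE ii'.
  by rewrite (nth_map (0, 0)%N) ?size_rank2_order.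
rewrite addKn (nth_map 0%N) ?size_rev ?size_iota//.
rewrite nth_rev ?size_iota// nth_iota; last by have := ltn_ord i'; lia.
by congr (g (_, _)); have := ltn_ord i'; lia.
Qed.

Lemma order_vec_loop_coefs0 m u :
  order_vec m.+1 (loop_coefs m.+1 0 u) = col_mx 0 (coef_block R m.+1 u).
Proof.
rewrite order_vecS; congr col_mx; apply/matrixP => i j; rewrite !mxE /loop_coefs /=.
  rewrite ifF//; apply/eqP.
  have : nth (0, 0)%N (rank2_order m) i \in rank2_order m by rewrite mem_nth ?size_rank2_order.
  by move=> /mem_rank2_order[l [p [_ _ ->]]].
by rewrite subn0; congr coef; have := ltn_ord i; lia.
Qed.

Lemma order_vec_loop_coefsS m l u :
  order_vec m.+1 (loop_coefs m.+1 l.+1 u) =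
  col_mx (order_vec m (loop_coefs m l u)) 0.
Proof.
by rewrite order_vecS; congr col_mx; apply/matrixP => i j; rewrite !mxE /loop_coefs.
Qed.

(** The candidates for the points [o_M]: rank 2 leaves at least two nonloops, and the nonloops
    outside the counted classes form singleton classes. *)
Definition is_coefs (n : nat) (v : 'cV[R]_(O2_nrows n)) := exists l u,
  [/\ (l.+2 <= n)%N, (part_sum (n - l) u <= n - l)%N & v = order_vec n (loop_coefs n l u)].

(** Without loops the vector lives in the new bottom block; otherwise removing a loop leads to the
    previous ground set. *)
Lemma is_coefsS m (v : 'cV_(O2_nrows m + m)) : (0 < m)%N ->
  is_coefs (n := m.+1) v <->
  (exists2 w, is_coefs w & v = col_mx w 0) \/
  (exists2 u, (part_sum m.+1 u <= m.+1)%N & v = col_mx 0 (coef_block R m.+1 u)).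
Proof.
move=> m0; split=> [[[|l] [u [ln us ->]]]|].
- by right; exists u; [move: us; rewrite subn0 | exact: order_vec_loop_coefs0].
- left; exists (order_vec m (loop_coefs m l u)); last exact: order_vec_loop_coefsS.
  by exists l, u; split=> //; move: us; rewrite subSS.
move=> [[_ [l [u [ln us ->]]] ->]|[u us ->]].
  by exists l.+1, u; split; rewrite ?subSS ?order_vec_loop_coefsS.
by exists 0%N, u; split; rewrite ?subn0 ?order_vec_loop_coefs0.
Qed.

Lemma order_vec4 g (i : 'I_6) : order_vec 4 g i 0 =
  [:: g (3, 4); g (2, 4); g (2, 3); g (1, 4); g (1, 3); g (1, 2)]%N`_i.
Proof. by rewrite mxE /=; case: i => [[|[|[|[|[|[|]]]]]]]. Qed.

Lemma is_col_O2_4 (v : 'cV_6) : is_col (O2_rec R 4) v <-> is_coefs (n := 4) v.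
Proof.
have coef1 m u : coef R m u 1 = 1 - (\sum_(2 <= q < m) u q)%N%:R by [].
have coef2 m u : coef R m u 2 = (u 2%N)%:R by [].
have coef3 m u : coef R m u 3 = (u 3%N)%:R by [].
have S22 (F : nat -> nat) : (\sum_(2 <= q < 2) F q = 0)%N by rewrite big_geq.
have S23 (F : nat -> nat) : (\sum_(2 <= q < 3) F q = F 2%N)%N by rewrite big_nat1.
(* The coordinates at S(3,4), S(2,4), S(2,3), S(1,4), S(1,3), S(1,2), for [l] loops. *)
pose bexp (l u2 u3 : nat) : seq R :=
  if l is 0 then [:: 0; 0; 0; u3%:R; u2%:R; 1 - (u2 + u3)%:R] else
  if l is 1 then [:: 0; u2%:R; 1 - u2%:R; 0; 0; 0] else [:: 1; 0; 0; 0; 0; 0].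
have cE l u : (l <= 2)%N ->
    order_vec 4 (loop_coefs 4 l u) = \col_(i < 6) (bexp l (u 2%N) (u 3%N))`_i.
  move=> l2; apply/matrixP => i j; rewrite (ord1 j) order_vec4 [RHS]mxE.
  case: l l2 => [|[|[|]]]// _; rewrite /loop_coefs /= ?subSS ?subn0 ?coef1
    ?coef2 ?coef3 ?S22 ?S23 ?big_nat24 ?subr0//.
have VE : is_col (O2_rec R 4) v <-> is_col (1%:M : 'M[R]_6) v \/
    is_col (\col_(i < 6) [:: 0; 0; 0; 0; 2; -1]`_i : 'cV[R]_6) v.
  exact: (@is_col_row_mx R 6 6 1 _ _ v).
have one (a : nat) (ha : (a < 6)%N) : col (Ordinal ha) (1%:M : 'M[R]_6) =
    \col_(i < 6) (nseq a 0 ++ 1 :: nseq (6 - a.+1) 0)`_i.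
  apply/matrixP => i i'; rewrite !mxE -val_eqE /= nth_cat nth_nseq size_nseq.
  case: ltngtP => [ia|ia|->]; rewrite ?subnn//.
  by rewrite -(subnSK ia) /= nth_nseq; case: ifP.
split.
  pose un (a b p : nat) := if p == 2%N then a else if p == 3%N then b else 0%N.
  have T l a b : (l <= 2)%N -> (part_sum (4 - l) (un a b) <= 4 - l)%N ->
      v = \col_(i < 6) (bexp l a b)`_i -> is_coefs (n := 4) v.
    by move=> l2 us ->; exists l, (un a b); rewrite cE.
  have ws4 a b : part_sum (4 - 0) (un a b) = (2 * a + 3 * b)%N by rewrite /part_sum big_nat24.
  have ws3 a b : part_sum (4 - 1) (un a b) = (2 * a)%N by rewrite /part_sum S23.
  have ws2 a b : part_sum (4 - 2) (un a b) = 0%N by rewrite /part_sum S22.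
  move=> /VE[[[j j6]]|[j]] vE; last first.
    (* The last column comes from two classes of size 2 and no loops. *)
    apply: (T 0%N 2%N 0%N); rewrite ?ws4// vE; apply/matrixP => i i'.
    rewrite !mxE /bexp; congr nth; do 5 congr cons; congr cons; lra.
  case: j j6 vE => [|[|[|[|[|[|]]]]]]// j6; rewrite one /= => vE.
  - by apply: (T 2%N 0%N 0%N); rewrite ?ws2// vE /bexp.
  - by apply: (T 1%N 1%N 0%N); rewrite ?ws3// vE /bexp subrr.
  - by apply: (T 1%N 0%N 0%N); rewrite ?ws3// vE /bexp subr0.
  - by apply: (T 0%N 0%N 1%N); rewrite ?ws4// vE /bexp subrr.
  - by apply: (T 0%N 1%N 0%N); rewrite ?ws4// vE /bexp subrr.
  - by apply: (T 0%N 0%N 0%N); rewrite ?ws4// vE /bexp subr0.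
move=> [l [u [l2 us vE]]]; apply/VE; rewrite vE cE// {vE}.
have idcol (a : nat) (ha : (a < 6)%N) w :
    w = \col_(i < 6) (nseq a 0 ++ 1 :: nseq (6 - a.+1) 0)`_i ->
    is_col (1%:M : 'M[R]_6) w.
  by move=> ->; exists (Ordinal ha); rewrite one.
case: l l2 us => [|[|[|]]]// _; rewrite /part_sum ?subn0 ?subSS ?S22 ?S23 ?big_nat24 /bexp.
- move: (u 2%N) (u 3%N) => [|[|[|a]]] [|[|b]]; try lia; move=> _.
  + by left; apply: (idcol 5) => //; rewrite /= subr0.
  + by left; apply: (idcol 3) => //; rewrite /= subrr.
  + by left; apply: (idcol 4) => //; rewrite /= subrr.
  + right; exists ord0; apply/matrixP => i i'.
    rewrite !mxE; congr nth; do 5 congr cons; congr cons; lra.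
- move: (u 2%N) => [|[|a]]; try lia; move=> _.
  + by left; apply: (idcol 2) => //; rewrite /= subr0.
  + by left; apply: (idcol 1) => //; rewrite /= subrr.
- by move=> _; left; apply: (idcol 0).
Qed.

Lemma is_col_O2 k v : is_col (O2_rec R k.+4) v <-> is_coefs v.
Proof.
elim: k v => [|k IH] v; first exact: is_col_O2_4.
have -> : O2_rec R k.+4.+1 = block_mx (O2_rec R k.+4) 0 0
   (row_mx (1%:M : 'M_(k.+4)) (V_mx R k.+4.+1)) by [].
rewrite block_mxEh.
have colO := @is_col_col_mx0 R _ k.+4 _ (O2_rec R k.+4).
have colI := @is_col_col_mx0l R (O2_nrows k.+4) k.+4 _
  (row_mx (1%:M : 'M_(k.+4)) (V_mx R k.+4.+1)).
rewrite (@is_coefsS k.+4)//; split.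
  move=> /is_col_row_mx[/colO[w /IH wc ->]|/colI[w /is_col_id_V[u us ->] ->]].
    by left; exists w.
  by right; exists u.
move=> [[w /IH wc ->]|[u us ->]]; apply/is_col_row_mx.
  by left; apply/colO; exists w.
by right; apply/colI; exists (coef_block R k.+4.+1 u) => //; apply/is_col_id_V; exists u.
Qed.

End O2.

(** * Matroids with prescribed class sizes *)

Section Shape.
Variables (n l : nat) (sh : seq nat).
Hypotheses (ln : (l.+2 <= n)%N) (shn : (sumn sh = n - l)%N).
Hypothesis sh_small : forall p, p \in sh -> (0 < p < n - l)%N.

(** After the loops, the classes are consecutive intervals of the lengths listed in [sh]. *)
Definition shape_col (i : 'I_n) : option 'I_(size sh) :=
  if (i < l)%N then None else insub (reshape_index sh (i - l)).

Lemma reshape_indexE r j : (r < size sh)%N -> (j < sumn sh)%N ->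
  (reshape_index sh j == r) =
  (sumn (take r sh) <= j < sumn (take r sh) + nth 0%N sh r)%N.
Proof.
move=> rs js; apply/eqP/idP => [<-|/andP[j1 j2]].
  have := reshape_offsetP js; have := reshape_indexK sh j.
  by rewrite /flatten_index; lia.
have -> : j = flatten_index sh r (j - sumn (take r sh)).
  by rewrite /flatten_index subnKC.
by rewrite flatten_indexKl// ltn_subLR.
Qed.

Lemma shape_col_isSome i : isSome (shape_col i) = (l <= i)%N.
Proof.
rewrite /shape_col; case: ltnP => // li; case: insubP => //= .
by rewrite reshape_indexP// shn; have := ltn_ord i; lia.
Qed.

Lemma col_loops_shape : col_loops shape_col = std_loops n l.
Proof.
apply/setP => i; rewrite !inE; have := shape_col_isSome i.
by case: (shape_col i) => [c|] /= /esym; [rewrite leqNgt => /negbTE|rewrite ltnNge => ->].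
Qed.

Lemma sumn_take r : (r < size sh)%N ->
  (sumn (take r sh) + nth 0 sh r <= n - l)%N.
Proof.
move=> rs; rewrite -shn -[in leqRHS](cat_take_drop r sh) sumn_cat leq_add2l.
by rewrite (drop_nth 0%N rs) /= leq_addr.
Qed.

Lemma card_class_shape c : #|col_class shape_col c| = nth 0%N sh c.
Proof.
have cs := ltn_ord c; have st := sumn_take cs.
have -> : col_class shape_col c = std_class n (l + sumn (take c sh)) (nth 0%N sh c).
  apply/setP => i; rewrite !inE /shape_col; have ii := ltn_ord i.
  case: ltnP => [il|li].
    by symmetry; apply/negbTE; lia.
  have isn : (i - l < sumn sh)%N by rewrite shn; lia.
  rewrite -[RHS](_ : (reshape_index sh (i - l) == c) = _); last first.
    by rewrite reshape_indexE//; lia.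
  case: insubP => [r _ <-|]; last by rewrite reshape_indexP.
  by apply/eqP/eqP => [[->]|/val_inj ->].
by rewrite card_std_class//; lia.
Qed.

Lemma num_classes_shape p : num_classes shape_col p = count_mem p sh.
Proof.
rewrite /num_classes -sum1dep_card -sum1_count (big_nth 0%N) big_mkord.
by apply: eq_bigl => c; rewrite card_class_shape.
Qed.

(** Each part is smaller than [n - l], so the class of the first nonloop misses another nonloop. *)
Lemma shape_col_nontrivial :
  exists i j, [/\ shape_col i, shape_col j & shape_col i != shape_col j].
Proof.
have ltn : (l < n)%N by lia.
have ci : isSome (shape_col (Ordinal ltn)) by rewrite shape_col_isSome /=.
case cE : (shape_col (Ordinal ltn)) ci => [c|//] _.
have cm : (#|col_class shape_col c| < #|~: std_loops n l|)%N.
  have -> : #|~: std_loops n l| = (n - l)%N.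
    have := cardsC (std_loops n l); rewrite card_ord card_std_loops; lia.
  rewrite card_class_shape.
  by have /andP[] := sh_small (mem_nth 0%N (ltn_ord c)).
have /subsetPn[j] : ~~ (~: std_loops n l \subset col_class shape_col c).
  by apply: contraL cm => /subset_leq_card; rewrite -leqNgt.
rewrite !inE -leqNgt => lj jc; exists (Ordinal ltn), j.
by rewrite cE shape_col_isSome; split=> //; rewrite eq_sym.
Qed.

End Shape.

Definition mult_shape (m : nat) (u : nat -> nat) : seq nat :=
  flatten [seq nseq (u p) p | p <- index_iota 2 m] ++ nseq (m - part_sum m u) 1%N.

Lemma sumn_mult_shape m u : (part_sum m u <= m)%N -> sumn (mult_shape m u) = m.
Proof.
move=> us; rewrite sumn_cat sumn_nseq mul1n sumn_flatten -map_comp.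
rewrite sumnE big_map (eq_bigr (fun p => p * u p)%N) => [|p _].
  by rewrite -/(part_sum m u) subnKC.
by rewrite /= sumn_nseq.
Qed.

Lemma mem_mult_shape m u p : (1 < m)%N -> p \in mult_shape m u -> (0 < p < m)%N.
Proof.
move=> m1; rewrite mem_cat mem_nseq => /orP[/flatten_mapP[q]|/andP[_ /eqP ->]//].
by rewrite mem_index_iota mem_nseq => qm /andP[_ /eqP ->]; lia.
Qed.

Lemma count_mult_shape m u p : (1 < p < m)%N -> count_mem p (mult_shape m u) = u p.
Proof.
move=> /andP[p1 pm]; rewrite count_cat count_flatten -map_comp sumnE big_map.
rewrite count_nseq /= [(1 == p)%N]ltn_eqF// mul0n addn0.
rewrite (eq_bigr (fun q => if q == p then u q else 0%N)) => [|q _].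
  by rewrite -big_mkcond big_nat1_eq p1 pm.
by rewrite /= count_nseq /=; case: eqP => _; rewrite ?mul1n.
Qed.

(** * The points [o_M] *)

Section Coefs.
Variables (R : realType) (n : nat).
Hypothesis hn : (3 <= n)%N.

Lemma sum_card_col_class (C : finType) (col : 'I_n -> option C) :
  (\sum_c #|col_class col c| = n - #|col_loops col|)%N.
Proof.
have -> : (n - #|col_loops col|)%N = #|~: col_loops col|.
  by rewrite -[X in (X - _)%N]card_ord -(cardsC (col_loops col)) addKn.
rewrite -[RHS]sum1_card [RHS]big_mkcond /=.
under eq_bigr do rewrite -sum1_card big_mkcond.
rewrite exchange_big /=; apply: eq_bigr => i _; rewrite !inE.
under eq_bigr do rewrite inE.
case: (col i) => [c|] /=; last by rewrite big1.
rewrite (bigD1 c)//= eqxx big1// => c' cc; rewrite ifF//.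
by apply/eqP => -[/esym/eqP]; exact/negP.
Qed.

Lemma part_sum_num_classes (C : finType) (col : 'I_n -> option C) m :
  m = (n - #|col_loops col|)%N -> (part_sum m (num_classes col) <= m)%N.
Proof.
move=> {2}->; rewrite -sum_card_col_class /part_sum.
under eq_bigr do rewrite /num_classes -sum1dep_card big_distrr /= big_mkcond /=.
rewrite exchange_big /=; apply: leq_sum => c _.
rewrite (eq_bigr (fun p => if p == #|col_class col c| then p else 0%N)).
  by rewrite -big_mkcond big_nat1_eq; case: ifP.
by move=> p _; rewrite muln1 eq_sym.
Qed.

Definition coef_vec (g : nat * nat -> R) : 'cV[R]_('C(n, 2)) :=
  \col_i g (nth (0, 0)%N (rank2_order n) i).

Lemma coef_vec_cast g : coef_vec g = castmx (O2_nrowsE n, erefl) (order_vec n g).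
Proof. by apply/matrixP => i j; rewrite castmxE !mxE. Qed.

(** The order has no repetitions, so an entry determines its index. *)
Lemma coef_vec_surj (a : 'cV[R]_('C(n, 2))) : exists g, a = coef_vec g.
Proof.
exists (fun s => if insub (index s (rank2_order n)) is Some i then a i 0 else 0).
apply/matrixP => i j; rewrite (ord1 j) mxE.
have si : (i < size (rank2_order n))%N by rewrite size_rank2_order O2_nrowsE.
rewrite index_uniq ?uniq_rank2_order//; case: insubP => [k _ /val_inj -> //|].
by rewrite ltn_ord.
Qed.

Lemma schubert_expansionE Bs (g : nat * nat -> R) :
  is_schubert_expansion Bs (coef_vec g) <-> forall x, sym_indic (base_polytope Bs) x =
    \sum_(l < n) \sum_(1 <= p < n - l)
      g (l.+1, (l + p).+1) * schubert_indic l p x.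
Proof.
have E x : \sum_(i < 'C(n, 2))
    (let S := nth (0, 0)%N (schubert2_order n) i in
     coef_vec g i 0 * sym_indic (base_polytope (schubert2 n S.1 S.2)) x) =
    \sum_(l < n) \sum_(1 <= p < n - l) g (l.+1, (l + p).+1) * schubert_indic l p x.
  under eq_bigr do rewrite mxE rank2_orderE//.
  rewrite -(big_mkord xpredT (fun i => g (nth (0, 0)%N (rank2_order n) i) *
    sym_indic (base_polytope (schubert2 n (nth (0, 0)%N (rank2_order n) i).1
      (nth (0, 0)%N (rank2_order n) i).2)) x)).
  rewrite -O2_nrowsE -size_rank2_order.
  rewrite -(big_nth (0, 0)%N xpredT (fun s => g s *
    sym_indic (base_polytope (schubert2 n s.1 s.2)) x)) big_rank2_order.
  apply: eq_bigr => l _; apply: eq_big_nat => p /andP[p0 pn].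
  by rewrite sym_indic_schubert2//; lia.
by split=> h x; [rewrite h E|rewrite h -E].
Qed.

Lemma schubert_expansion_inj Bs (a b : 'cV[R]_('C(n, 2))) :
  is_schubert_expansion Bs a -> is_schubert_expansion Bs b -> a = b.
Proof.
have [g ->] := coef_vec_surj a; have [h ->] := coef_vec_surj b.
move=> /schubert_expansionE gE /schubert_expansionE hE.
apply/matrixP => i j; rewrite !mxE; apply/eqP; rewrite -subr_eq0.
have /mem_rank2_order[l [p [p0 lpn ->]]] : nth (0, 0)%N (rank2_order n) i \in rank2_order n.
  by rewrite mem_nth// size_rank2_order O2_nrowsE.
apply/eqP.
apply: (@schubert_indic_free R n
  (fun l p => g (l.+1, (l + p).+1) - h (l.+1, (l + p).+1))) => // x.
under eq_bigr do under eq_bigr do rewrite mulrBl.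
under eq_bigr do rewrite sumrB.
by rewrite sumrB -gE -hE subrr.
Qed.

Lemma col_expansion (C : finType) (col : 'I_n -> option C) i j u
    (l := #|col_loops col|) :
  col i -> col j -> col i != col j ->
  (forall p, (1 < p < n - l)%N -> num_classes col p = u p) ->
  is_schubert_expansion (col_bases col) (coef_vec (loop_coefs R n l u)).
Proof.
move=> ci cj cij nu; apply/schubert_expansionE => x.
rewrite (sym_indic_col x ci cj cij) -/l.
have ln : (l < n)%N.
  rewrite -[ltnRHS]card_ord -cardsT; apply/proper_card/properP.
  by split; [exact: subsetT | exists i; rewrite // !inE; case: (col i) ci].
rewrite (bigD1 (Ordinal ln))//= [X in _ = _ + X]big1 ?addr0 => [|k kl].
  apply: eq_big_nat => p /andP[p0 pn]; rewrite /loop_coefs /= eqxx subSS addKn.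
  congr (_ * _); rewrite /coef; case: eqP => [_|p1].
    by congr (1 - _%:R); apply: eq_big_nat => q qn; apply: nu.
  by rewrite nu//; lia.
apply: big1 => p _; rewrite /loop_coefs /= eqSS.
by rewrite -val_eqE /= in kl; rewrite (negbTE kl) mul0r.
Qed.

(** In one direction a matroid with the given class sizes is built; in the other, uniqueness
    identifies the given expansion with the one computed from a coloring. *)
Lemma coefs_matroidP (v : 'cV[R]_(O2_nrows n)) :
  is_coefs v <-> exists2 Bs, is_matroid 2 Bs &
    is_schubert_expansion Bs (castmx (O2_nrowsE n, erefl) v).
Proof.
split=> [[l [u [ln us ->]]]|[Bs /matroid_coloring[col -> [i [j [ci cj cij]]]]]].
  pose sh := mult_shape (n - l) u.
  have shn : sumn sh = (n - l)%N by exact: sumn_mult_shape.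
  have sh1 p : p \in sh -> (0 < p < n - l)%N by apply: mem_mult_shape; lia.
  have [i [j [ci cj cij]]] := shape_col_nontrivial ln shn sh1.
  exists (col_bases (@shape_col n l sh)); first exact: col_bases_matroid ci cj cij.
  have cl : #|col_loops (@shape_col n l sh)| = l.
    by rewrite col_loops_shape// card_std_loops//; lia.
  rewrite -coef_vec_cast -[in loop_coefs R n l u]cl.
  apply: (col_expansion ci cj cij) => p; rewrite cl => pn.
  by rewrite num_classes_shape// count_mult_shape.
have := col_expansion ci cj cij (fun _ _ => erefl).
move=> e1 e2; have := schubert_expansion_inj e1 e2.
rewrite coef_vec_cast => /(can_inj (castmxK (O2_nrowsE n) erefl)) <-.
exists #|col_loops col|, (num_classes col); split=> //.
  have ij : [set i; j] \subset ~: col_loops col.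
    apply/subsetP => k; rewrite !inE => /orP[] /eqP ->.
      by case: (col i) ci.
    by case: (col j) cj.
  have := subset_leq_card ij; rewrite cards2.
  have := cardsC (col_loops col); rewrite [in RHS]card_ord => nE.
  case: (eqVneq i j) cij => [->|_ _]; rewrite ?eqxx//= => c2.
  by rewrite -[leqRHS]nE -addn2 leq_add2l.
exact: part_sum_num_classes.
Qed.

End Coefs.

Theorem theorem3p6 (R : realType) (n : nat) (hn : (4 <= n)%N) :
  convex_hull (range (fun j : 'I_(O2_ncols n) => col j (O2_mx R n))) =
  Omega2 R n.
Proof.
have hn3 : (3 <= n)%N := ltnW hn.
have colE j : col j (O2_mx R n) = castmx (O2_nrowsE n, erefl) (col j (O2_rec R n)).
  by apply/matrixP => i k; rewrite !(mxE, castmxE) /= cast_ord_id.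
have is_colE v : is_col (O2_rec R n) v <-> is_coefs v.
  by case: n hn {hn3 colE} v => [|[|[|[|k]]]]// _; exact: is_col_O2.
(* The generating sets agree already before taking hulls. *)
congr convex_hull; apply/seteqP; split=> [_ [j _ <-]|a [Bs mB aB]] /=.
  rewrite colE; apply/(coefs_matroidP hn3)/is_colE; by exists j.
have [j vE] : is_col (O2_rec R n) (castmx (esym (O2_nrowsE n), erefl) a).
  apply/is_colE/(coefs_matroidP hn3); exists Bs => //.
  by rewrite castmxKV.
exists j => //; rewrite colE -vE castmxKV //.
Qed.
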